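(* Let $K\in\mathcal{P}(m,n)$ ($3\le n\le m$) and let $A$ be a $K$-nonnegative matrix. Suppose that the pairwise distinct extreme vectors of $K$ are labelled $x_1,\ldots,x_m$ so that the digraph $(\mathcal{E},\mathcal{P}(A,K))$ is given by $F_1$ or $F_2$ (with $\Phi(x_i)$ in the role of vertex $x_i$). Then: (i) $A$ is $K$-primitive, nonsingular, non-derogatory, and has a unique annihilating polynomial of the form $t^m-ct-d$, where $c,d>0$. (ii) $\gamma(A)$ equals $\gamma(A,x_1)$ or $\gamma(A,x_2)$ depending on whether the digraph $(\mathcal{E},\mathcal{P}(A,K))$ is given by $F_1$ or $F_2$. In either case, $\max_{1\le i\le m}\gamma(A,x_i)$ is attained at precisely one $i$. (iii) Assume, in addition, that $K$ is non-simplicial. If $(\mathcal{E},\mathcal{P}(A,K))$ is given by $F_1$, then $K$ must be indecomposable. If the digraph is given by $F_2$, then either $K$ is indecomposable, or $m$ is odd and $K$ is the direct sum of a ray and an indecomposable minimal cone with a balanced relation for its extreme vectors.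
   Context: A proper cone $K$ in $\mathbb{R}^n$ is a closed convex cone that is pointed ($K\cap(-K)=\{0\}$) and has nonempty interior. A face of $K$ is a subcone $F\subseteq K$ such that $y\in F$ whenever $x\in F$ and $y,x-y\in K$. For $x\in K$, $\Phi(x)$ is the smallest face of $K$ containing $x$. A nonzero $x\in K$ is an extreme vector if $\Phi(x)=\{\lambda x:\lambda\ge0\}$, which is then an extreme ray; extreme vectors are distinct if they are not multiples of each other. A polyhedral cone is a proper cone (in its linear span) with finitely many extreme rays; $\mathcal{P}(m,n)$ is the set of $n$-dimensional polyhedral cones with exactly $m$ extreme rays. A polyhedral cone is simplicial if the number of its extreme rays equals its dimension, and is minimal if the number of its extreme rays is one more than its dimension. The extreme vectors of a minimal cone satisfy, up to scalar multiples, a unique nonzero linear relation, written $\alpha_1u_1+\cdots+\alpha_pu_p=\beta_1v_1+\cdots+\beta_qv_q$ with all coefficients positive and all $u_i,v_j$ pairwise distinct extreme vectors; it is balanced if $|p-q|\le1$. A closed pointed cone is decomposable if it is the direct sum of two nonzero subcones, and indecomposable otherwise. $\pi(K)$ is the set of real $n\times n$ matrices $A$ with $AK\subseteq K$ (called $K$-nonnegative). $A\in\pi(K)$ is $K$-primitive if $A^p(K\setminus\{0\})\subseteq\operatorname{int}K$ for some positive integer $p$; the least such $p$ is the exponent $\gamma(A)$. For $0\ne x\in K$, the local exponent $\gamma(A,x)$ is the smallest nonnegative integer $k$ with $A^kx\in\operatorname{int}K$ ($\infty$ if none). A matrix is non-derogatory if its minimal and characteristic polynomials coincide. $(\mathcal{E},\mathcal{P}(A,K))$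 is the digraph whose vertices are the extreme rays of $K$, with an arc $(\Phi(x),\Phi(y))$ whenever $\Phi(y)\subseteq\Phi(Ax)$. $F_1$ is the digraph on vertices $x_1,\ldots,x_m$ with arcs $x_i\to x_{i+1}$ ($1\le i\le m-1$), $x_m\to x_1$ and $x_m\to x_2$. $F_2$ is $F_1$ together with the additional arc $x_1\to x_3$. *)

(* Defs.v *)
From HB Require Import structures.
From mathcomp Require Import all_boot all_order all_algebra.
From mathcomp Require Import all_classical all_reals all_analysis.

Set Implicit Arguments.
Unset Strict Implicit.
Unset Printing Implicit Defensive.

Import Order.TTheory GRing.Theory Num.Theory numFieldNormedType.Exports.

Local Open Scope classical_set_scope.
Local Open Scope ring_scope.

Section LinearSpan.
Context {F : fieldType} {V : vectType F}.
Implicit Types (K : set V) (U : {vspace V}).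

Lemma lspan_subproof K : exists U,
  K `<=` [set` U] /\ forall W : {vspace V}, K `<=` [set` W] -> (U <= W)%VS.
Proof.
pose P d := `[< exists2 U : {vspace V}, K `<=` [set` U] & \dim U = d >].
have exP : exists d, P d.
  by exists (\dim {:V}); apply/asboolP; exists fullv => // x _ /=; exact: memvf.
case: (ex_minnP exP) => d /asboolP[U KU dimU] dmin.
exists U; split=> // W KW; apply/capv_idPl/eqP.
rewrite eqEdim capvSl /= dimU; apply: dmin; apply/asboolP.
exists (U :&: W)%VS => // x Kx /=; rewrite memv_cap.
by apply/andP; split; [exact: KU|exact: KW].
Qed.

Definition lspan K : {vspace V} := sval (cid (lspan_subproof K)).

Lemma sub_lspan K : K `<=` [set` lspan K].
Proof. exact: (svalP (cid (lspan_subproof K))).1. Qed.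

Lemma lspan_min K U : K `<=` [set` U] -> (lspan K <= U)%VS.
Proof. exact: (svalP (cid (lspan_subproof K))).2. Qed.

End LinearSpan.

(* The least element of a set of natural numbers, +oo when it is empty. *)
Definition least (P : set nat) : \bar int :=
  match pselect (exists k, `[< P k >]) with
  | left exP => (ex_minn exP)%:Z%:E
  | right _ => +oo%E
  end.

Lemma leastP (P : set nat) (k : nat) :
  least P = k%:Z%:E <-> P k /\ (forall j : nat, P j -> (k <= j)%N).
Proof.
rewrite /least; case: pselect => [exP|nP]; last first.
  by split=> // -[Pk _]; case: nP; exists k; apply/asboolP.
case: ex_minnP => l /asboolP Pl lmin; split.
  by move=> [<-]; split=> // j Pj; apply/lmin/asboolP.
move=> [Pk kmin]; congr ((Posz _)%:E); apply/eqP; rewrite eqn_leq.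
by rewrite kmin // andbT; apply/lmin/asboolP.
Qed.

Section Cones.
Context {R : realType} {n : nat}.
Local Notation V := 'cV[R]_n.
Implicit Types (K F : set V) (x y z : V) (A : 'M[R]_n).

Definition convex_cone K :=
  [/\ K 0, forall x y, K x -> K y -> K (x + y)
    & forall (a : R) x, 0 <= a -> K x -> K (a *: x)].

Definition pointed_cone K := K `&` [set x | K (- x)] = [set 0].

Definition cone_dim K : nat := \dim (lspan K).

(* Interior of K relative to its linear span. *)
Definition relint K : set V :=
  [set x | K x /\ \forall y \near x, y \in lspan K -> K y].

Lemma relintE K : lspan K = fullv -> relint K = K°.
Proof.
move=> Kf; apply/seteqP; split=> x /=.
  by case=> _; apply: filterS => y; apply; rewrite Kf memvf.
by move=> Kx; split; [exact: nbhs_singleton|apply: filterS Kx].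
Qed.

(* A proper cone in its linear span; when [lspan K = fullv], [relintE] makes
   this a proper cone of the whole space. *)
Definition proper_cone K :=
  [/\ closed K, convex_cone K, pointed_cone K & relint K !=set0].

Definition face K F :=
  [/\ convex_cone F, F `<=` K
    & forall x y, F x -> K y -> K (x - y) -> F y].

(* The smallest face of K containing x, the paper's Phi(x). *)
Definition Phi K x : set V := smallest (face K) [set x].

Definition ray x : set V := [set a *: x | a in [set a : R | 0 <= a]].

Definition extreme_vector K x := [/\ K x, x != 0 & Phi K x = ray x].

Definition extreme_rays K : set (set V) :=
  [set Phi K x | x in extreme_vector K].

(* A family of pairwise distinct extreme vectors, where distinct means not
   multiples of each other. *)
Definition distinct_extreme_vectors K (I : Type) (x : I -> V) :=
  (forall i, extreme_vector K (x i)) /\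
  (forall i j, i <> j -> ~ exists a : R, x i = a *: x j).

(* K is in P(m, d). *)
Definition polyhedral_cone (m d : nat) K :=
  [/\ proper_cone K, cone_dim K = d & (extreme_rays K #= `I_m)%card].

Definition simplicial K := polyhedral_cone (cone_dim K) (cone_dim K) K.

Definition minimal_cone K := polyhedral_cone (cone_dim K).+1 (cone_dim K) K.

(* A nonzero relation \sum_i alpha_i u_i = \sum_j beta_j v_j with positive
   coefficients between pairwise distinct extreme vectors. *)
Definition extreme_relation K (p q : nat)
    (alpha : 'I_p -> R) (u : 'I_p -> V) (beta : 'I_q -> R) (v : 'I_q -> V) :=
  [/\ (0 < p + q)%N,
      (forall i, 0 < alpha i) /\ (forall j, 0 < beta j),
      distinct_extreme_vectors K
        (fun s : 'I_p + 'I_q => match s with inl i => u i | inr j => v j end)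
    & \sum_i alpha i *: u i = \sum_j beta j *: v j].

(* For a minimal cone the relation is unique up to scaling and exchanging the
   two sides, so existence of a balanced one says that the relation is
   balanced. *)
Definition balanced K :=
  exists (p q : nat) (alpha : 'I_p -> R) (u : 'I_p -> V)
         (beta : 'I_q -> R) (v : 'I_q -> V),
    extreme_relation K alpha u beta v /\ (p <= q.+1)%N /\ (q <= p.+1)%N.

Definition direct_sum K K1 K2 :=
  [/\ convex_cone K1, convex_cone K2,
      K = [set y + z | y in K1 & z in K2]
    & (lspan K1 :&: lspan K2)%VS = 0%VS].

Definition decomposable K :=
  exists K1 K2, [/\ direct_sum K K1 K2, K1 <> [set 0] & K2 <> [set 0]].

Definition indecomposable K := ~ decomposable K.

Definition cone_nonneg K A := forall x, K x -> K (A *m x).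

Definition primitive_power K A (p : nat) :=
  (0 < p)%N /\ forall x, K x -> x != 0 -> K° (A ^+ p *m x).

Definition cone_primitive K A :=
  cone_nonneg K A /\ exists p, primitive_power K A p.

Definition exponent K A : \bar int := least (primitive_power K A).

Definition local_exponent K A x : \bar int :=
  least [set k | K° (A ^+ k *m x)].

(* The arcs of the digraph (E, P(A, K)), between extreme rays. *)
Definition cone_arc K A (E G : set V) :=
  exists x y, [/\ extreme_vector K x, extreme_vector K y,
    E = Phi K x, G = Phi K y & Phi K y `<=` Phi K (A *m x)].

(* x_1, ..., x_m are the extreme vectors of K (up to multiples). *)
Definition extreme_labelling K (m : nat) (x : 'I_m -> V) :=
  distinct_extreme_vectors K x /\
  (forall y, extreme_vector K y -> exists i, Phi K y = Phi K (x i)).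

(* The digraph (E, P(A, K)) is e, with Phi(x_i) as vertex i. *)
Definition digraph_given_by K A (m : nat) (x : 'I_m -> V) (e : rel 'I_m) :=
  forall i j, cone_arc K A (Phi K (x i)) (Phi K (x j)) <-> e i j.

End Cones.

(* Vertex x_(i+1) is the ordinal i. *)
Definition F1 (m : nat) : rel 'I_m := fun i j =>
  (j == i.+1 :> nat) || ((i.+1 == m) && ((j == 0 :> nat) || (j == 1 :> nat))).

Definition F2 (m : nat) : rel 'I_m := fun i j =>
  F1 i j || ((i == 0 :> nat) && (j == 2 :> nat)).

Definition nonderogatory {F : fieldType} {n : nat} (A : 'M[F]_n.+1) :=
  mxminpoly A = char_poly A.

(* Main.v *)
(* Number the vertices from 0 to M = m - 1. A closed pointed cone is generated by
   its extreme vectors, so the digraph gives, after rescaling, A x_i = x_(i+1)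
   away from the vertices with two successors, where A x_i is a positive
   combination of the two. Hence v = x_0 (for F1) or v = x_1 (for F2) is a
   cyclic vector of A and (A^m - c A - d) v = 0 with c, d > 0, which makes A
   nonsingular and non-derogatory and annihilated by t^m - c t - d. Moreover
   A^(m(m-1)) v = (c A + d)^(m-1) v is a positive combination of v, A v, ...,
   A^(m-1) v, hence interior. Every other x_i is a multiple of some A^k v with
   k > 0, or is the vector x_0 of F2, and so reaches the interior earlier than v.

   If K is decomposable, there is a nontrivial set I of vertices and a projection
   P with P x_i = x_i for i in I and P x_i = 0 otherwise. The conjugates
   A P A^-1 and A^-1 P A are again of this form, with I shifted by one, except
   near the vertices with two successors; combining them there one finds an x_k
   outside the span of the other x_i. In a non-simplicial cone this is impossible
   for F1, and for F2 it forces k = 1. In the latter case A^-1 acts on the linear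
   relations among the x_i so rigidly that, up to scaling, there is only one: a
   geometric progression of negative ratio over all vertices but 1. *)

Require Import Defs.
From HB Require Import structures.
From mathcomp Require Import all_boot all_order all_algebra.
From mathcomp Require Import all_classical all_reals all_analysis.
From mathcomp Require Import ring zify.
Import Order.TTheory GRing.Theory Num.Theory numFieldNormedType.Exports.
Local Open Scope classical_set_scope.
Local Open Scope ring_scope.
Set Implicit Arguments.
Unset Strict Implicit.
Unset Printing Implicit Defensive.

(** * Linear relations along a nearly cyclic orbit *)

Section Separators.
Context {F : fieldType} {N : nat} (M : nat) (y : nat -> 'cV[F]_N).
Implicit Types (I J : nat -> bool) (u : nat -> F).

Definition linear_relation u := \sum_(i < M.+1) u i *: y i = 0.

(* Says that the span of the [y i] with [i] in [I] and the span of the other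
   [y i] meet only in 0; [P] projects onto the former along the latter. *)
Definition separator I :=
  exists P : 'M[F]_N, forall i, (i <= M)%N -> P *m y i = (I i)%:R *: y i.

(* Equivalently, [y k] is not in the span of the other [y i]. *)
Definition isolated_vertex k := exists2 B : 'M[F]_N,
  B *m y k != 0 & forall i, (i <= M)%N -> i != k -> B *m y i = 0.

Lemma separatorC I : separator I -> separator (fun i => ~~ I i).
Proof.
case=> P PI; exists (1%:M - P) => i iM.
by rewrite mulmxBl mul1mx PI//; case: (I i); rewrite ?scale1r ?scale0r ?subrr ?subr0.
Qed.

Lemma separatorI I J : separator I -> separator J -> separator (fun i => I i && J i).
Proof.
case=> P PI [Q QJ]; exists (P *m Q) => i iM.
rewrite -mulmxA QJ// -scalemxAr PI// scalerA.
by case: (I i); case: (J i); rewrite ?mulr1 ?mulr0 ?mul0r.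
Qed.

Lemma isolated_relation0 k u : (k <= M)%N -> isolated_vertex k -> linear_relation u -> u k = 0.
Proof.
move=> kM [B Bk B0] /(congr1 (mulmx B)); rewrite mulmx0 mulmx_sumr.
rewrite (bigD1 (Ordinal (kM : (k < M.+1)%N)))//= big1 => [|i ik]; last first.
  by rewrite -scalemxAr B0 ?scaler0 // -ltnS.
by rewrite addr0 -scalemxAr => /eqP; rewrite scaler_eq0 (negbTE Bk) orbF => /eqP.
Qed.

End Separators.

(** * Separators and relations when only the last vertex branches, as in [F1] *)

Section Wielandt.
Context {F : fieldType} {N M : nat} (y : nat -> 'cV[F]_N) (A : 'M[F]_N) (a b : F).
Implicit Types (I J : nat -> bool) (u : nat -> F).
Hypotheses (M2 : (1 < M)%N) (A_unit : A \in unitmx).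
Hypotheses (a0 : a != 0) (b0 : b != 0) (y1 : y 1 != 0).
Hypotheses (Ay : forall i, (i < M)%N -> A *m y i = y i.+1).
Hypothesis AyM : A *m y M = a *: y 0 + b *: y 1.
Let A' := invmx A.

Local Lemma A'y i : (i < M)%N -> A' *m y i.+1 = y i.
Proof. by move=> iM; rewrite -Ay// mulmxA mulVmx// mul1mx. Qed.

Local Lemma A'y0 : A' *m y 0 = a^-1 *: (y M - b *: y 0).
Proof.
have /(congr1 (mulmx A')) := AyM; rewrite mulmxA mulVmx// mul1mx mulmxDr -!scalemxAr.
rewrite A'y ?(ltnW M2)// => ->; rewrite addrK scalerA mulVf// scale1r //.
Qed.

(** Applying [B A^-k] to the relation kills the terms after [k], because [A^-k] moves them to
    vertices other than 0. The coefficients before [k] vanish by induction, so only [u k *: B (y 0)]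
    remains. *)
Lemma wielandt_not_isolated u : linear_relation M y u -> isolated_vertex M y 0 ->
  forall k, (k <= M)%N -> u k = 0.
Proof.
move=> ru [B B0 Bi] k; elim/ltn_ind: k => k IH kM.
pose C := B *m iter k (mulmx A') 1%:M.
have A'k j i : (j <= i)%N -> (i <= M)%N -> iter j (mulmx A') 1%:M *m y i = y (i - j)%N.
  elim: j i => [|j IHj] i; first by rewrite /= mul1mx subn0.
  move=> ji iM; rewrite /= -mulmxA IHj ?(ltnW ji)// -[(i - j)%N]prednK ?subn_gt0//.
  by rewrite A'y ?subnS//; lia.
move/(congr1 (mulmx C)): ru; rewrite mulmx0 mulmx_sumr.
rewrite (bigD1 (Ordinal (kM : (k < M.+1)%N)))//= big1 ?addr0 => [|i ik].
  rewrite -scalemxAr /C -mulmxA A'k// subnn => /eqP.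
  by rewrite scaler_eq0 (negbTE B0) orbF => /eqP.
have iM : (i <= M)%N by rewrite -ltnS.
have nik : i != k :> nat := ik.
case: (ltngtP i k) nik => // ik' _; first by rewrite IH// scale0r mulmx0.
rewrite -scalemxAr /C -mulmxA A'k ?(ltnW ik')// Bi ?scaler0 //; last by rewrite subn_eq0 -ltnNge.
exact: leq_trans (leq_subr _ _) iM.
Qed.

(** The conjugate [A P A^-1] acts on [y i.+1] as [P] does on [y i]. It kills [y 0], because
    [A^-1 y 0] is a combination of [y 0] and [y M], both killed by [P]. *)
Local Lemma separator_up I : separator M y I -> ~~ I 0 -> ~~ I M ->
  separator M y (fun i => (0 < i)%N && I i.-1).
Proof.
move=> [P PI] I0 IM; exists (A *m P *m A') => -[_|i iM].
  rewrite -mulmxA A'y0 -!scalemxAr mulmxBr -scalemxAr -!mulmxA PI// PI//.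
  by rewrite (negbTE I0) (negbTE IM) !scale0r !mulmx0 !scaler0 subr0 scaler0.
by rewrite -!mulmxA A'y// PI ?(ltnW iM)// -scalemxAr Ay.
Qed.

(** Here the conjugate is [A^-1 P A]; it kills [y M] because [P] kills both [y 0] and [y 1]. *)
Local Lemma separator_down I : separator M y I -> ~~ I 0 -> ~~ I 1 ->
  separator M y (fun i => (i < M)%N && I i.+1).
Proof.
move=> [P PI] I0 I1; exists (A' *m P *m A) => i.
rewrite leq_eqVlt => /predU1P[->|iM].
  rewrite ltnn -!mulmxA AyM !mulmxDr -!scalemxAr PI// PI ?(ltnW M2)//.
  by rewrite (negbTE I0) (negbTE I1) !scale0r !mulmx0 !scaler0 addr0.
by rewrite -!mulmxA Ay// PI// -scalemxAr A'y// iM.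
Qed.

(** Away from [y 0] the matrix [A P A^-1] is diagonal, so [(1 - P) (A P A^-1) P] vanishes there. On
    [y 0], the [y 0]-part of [A^-1 y 0] survives [P] and is carried by [A] to a nonzero multiple of
    [y 1], which [1 - P] keeps. *)
Local Lemma separator_isolated0 I : separator M y I -> I 0 -> ~~ I 1 -> ~~ I M ->
  isolated_vertex M y 0.
Proof.
move=> [P PI] I0 I1 IM.
have M1 := ltnW M2.
exists ((1%:M - P) *m (A *m P *m A') *m P); last first.
  move=> [//|i iM _]; rewrite -!mulmxA PI// -!scalemxAr A'y// PI ?(ltnW iM)//.
  rewrite -!scalemxAr Ay// mulmxBl mul1mx PI//.
  by case: (I i.+1); rewrite ?scale0r ?scaler0 ?scale1r ?subrr ?scaler0.
rewrite -!mulmxA PI// I0 scale1r A'y0 -!scalemxAr mulmxBr -scalemxAr PI// PI//.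
rewrite I0 (negbTE IM) scale0r scale1r sub0r !mulmxN -!scalemxAr Ay// mulmxBl mul1mx.
by rewrite PI// (negbTE I1) scale0r subr0 scaler_eq0 invr_eq0 (negbTE a0) oppr_eq0 scaler_eq0 (negbTE b0).
Qed.

Local Lemma separator_up_iter I k : separator M y I -> ~~ I 0 -> (k <= M)%N -> I k ->
  exists J, [/\ separator M y J, ~~ J 0 & J M].
Proof.
(* Induction on the distance from [k] to [M]: each shift brings a member of the set one step closer
   to [M]. *)
move=> + + kM; move: {-2}(M - k)%N (erefl (M - k)%N) => d.
elim: d k I kM => [|d IH] k I kM dE sI I0 Ik.
  have -> : M = k by apply/eqP; rewrite eqn_leq kM andbT -subn_eq0 dE.
  by exists I; split=> //; have -> : k = M by lia.
case: (boolP (I M)) => IM; first by exists I.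
by apply: (IH k.+1 _ _ _ (separator_up sI I0 IM)) => //; lia.
Qed.

Local Lemma separator_down_iter I k : separator M y I -> ~~ I 0 -> (k < M)%N -> I k.+1 ->
  exists J, [/\ separator M y J, ~~ J 0 & J 1].
Proof.
elim: k I => [|k IH] I sI I0 kM Ik; first by exists I.
case: (boolP (I 1)) => I1; first by exists I.
apply: (IH _ (separator_down sI I0 I1)); rewrite ?(ltnW kM) ?kM //.
by rewrite negb_and I1 orbT.
Qed.


(** A nonconstant [I] would yield a separator containing 0 but neither 1 nor [M]. Then [y 0] would
    be isolated, which a nontrivial relation forbids. *)
Lemma wielandt_connected I u : separator M y I -> linear_relation M y u ->
  (exists2 k, (k <= M)%N & u k != 0) -> forall k, (k <= M)%N -> I k = I 0.
Proof.
move=> sI ru [l lM ul] k kM; apply/eqP/negPn/negP => Ik0.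
have niso : ~ isolated_vertex M y 0.
  by move=> iso; move: ul; rewrite (wielandt_not_isolated ru)// eqxx.
have [J [sJ J0 JM]] : exists J, [/\ separator M y J, ~~ J 0 & J M].
  case I0: (I 0); last first.
    by apply: (separator_up_iter sI _ kM); [rewrite I0|move: Ik0; rewrite I0; case: (I k)].
  by apply: (separator_up_iter (separatorC sI) _ kM); [rewrite I0|move: Ik0; rewrite I0; case: (I k)].
(* If 1 is in [J], the complement of [J] serves. Otherwise [J] is shifted down until 1 enters,
   giving [J'], and the intersection of the two complements serves: [J] removes [M] and [J'] removes
   1. *)
case: (boolP (J 1)) => J1.
  by apply: niso; apply: (separator_isolated0 (separatorC sJ)); rewrite ?J1 ?JM.
have M0 : (0 < M)%N by exact: ltnW.
have [J' [sJ' J'0 J'1]] : exists J, [/\ separator M y J, ~~ J 0 & J 1%N].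
  by apply: (separator_down_iter (k := M.-1) sJ J0); rewrite prednK.
have sC := separatorI (separatorC sJ) (separatorC sJ').
by apply: niso; apply: (separator_isolated0 sC); rewrite ?J0 ?J'0 ?J'1 ?JM ?andbF.
Qed.
End Wielandt.

Lemma sum_ord_recl2 (V : nmodType) (M : nat) (G : nat -> V) : (0 < M)%N ->
  \sum_(i < M.+1) G i = G 0%N + G 1%N + \sum_(i < M.-1) G i.+2.
Proof. by case: M => // k _; rewrite !big_ord_recl /= addrA. Qed.

(** * Separators and relations when vertex 0 branches as well, as in [F2] *)

Section NearWielandt.
Context {F : realFieldType} {N M : nat} (y : nat -> 'cV[F]_N) (A : 'M[F]_N) (a b e : F).
Implicit Types (I J : nat -> bool) (u : nat -> F).
Hypotheses (M3 : (2 < M)%N) (A_unit : A \in unitmx).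
Hypotheses (a_gt0 : 0 < a) (b_gt0 : 0 < b) (e_gt0 : 0 < e).
Hypothesis yneq0 : forall i, (i <= M)%N -> y i != 0.
Hypothesis Ay0 : A *m y 0 = a *: y 1 + b *: y 2.
Hypothesis Ay : forall i, (0 < i)%N -> (i < M)%N -> A *m y i = y i.+1.
Hypothesis AyM : A *m y M = y 0 + e *: y 1.
Let A' := invmx A.
Let M0 : (0 < M)%N := ltnW (ltnW M3).
Let M1 : (1 < M)%N := ltnW M3.
Let a0 : a != 0. Proof. by rewrite gt_eqF. Qed.
Let b0 : b != 0. Proof. by rewrite gt_eqF. Qed.
Let e0 : e != 0. Proof. by rewrite gt_eqF. Qed.

Local Lemma near_A'y i : (0 < i)%N -> (i < M)%N -> A' *m y i.+1 = y i.
Proof. by move=> i0 iM; rewrite -Ay// mulmxA mulVmx// mul1mx. Qed.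

Local Lemma near_A'y1 : A' *m y 1 = a^-1 *: (y 0 - b *: y 1).
Proof.
have /(congr1 (mulmx A')) := Ay0; rewrite mulmxA mulVmx// mul1mx mulmxDr -!scalemxAr.
by rewrite (@near_A'y 1)// => ->; rewrite addrK scalerA mulVf// scale1r.
Qed.

Local Lemma near_A'y0 : A' *m y 0 = y M - (e / a) *: (y 0 - b *: y 1).
Proof.
have /(congr1 (mulmx A')) := AyM; rewrite mulmxA mulVmx// mul1mx mulmxDr -!scalemxAr.
by rewrite near_A'y1 => ->; rewrite scalerA addrK.
Qed.

(* The action of [A^-1] on the coefficients of linear relations. *)
Let shift u i : F :=
  if i == M then u 0 else if i == 0 then a^-1 * (u 1 - e * u 0)
  else if i == 1 then u 2 - b * (a^-1 * (u 1 - e * u 0)) else u i.+1.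

Local Lemma relation_shift u : linear_relation M y u -> linear_relation M y (shift u).
Proof.
rewrite /linear_relation => /(congr1 (mulmx A')); rewrite mulmx0 mulmx_sumr => R0; rewrite -[RHS]R0 {R0}.
rewrite [LHS](sum_ord_recl2 (fun i => shift u i *: y i) M0)
  [RHS](sum_ord_recl2 (fun i => A' *m (u i *: y i)) M0).
have -> : M.-1 = M.-2.+1 by rewrite prednK// -subn1 subn_gt0.
have kM : M.-2.+2 = M by case: M M1 => [|[]].
rewrite [in LHS]big_ord_recr [in RHS]big_ord_recl /= kM -!scalemxAr.
rewrite near_A'y1 near_A'y0 (@near_A'y 1)//.
have -> : \sum_(i < M.-2) A' *m (u (bump 0 i).+2 *: y (bump 0 i).+2) =
   \sum_(i < M.-2) u i.+3 *: y i.+2.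
  by apply: eq_bigr => i _; rewrite -scalemxAr near_A'y// -[X in (_ < X)%N]kM !ltnS.
have -> : \sum_(i < M.-2) shift u i.+2 *: y i.+2 = \sum_(i < M.-2) u i.+3 *: y i.+2.
  by apply: eq_bigr => i _; rewrite /shift ltn_eqF// -[X in (_ < X)%N]kM !ltnS.
rewrite /shift eqxx (ltn_eqF M0) (ltn_eqF M1) /=.
move: (\sum_(i < _) _) => s.
apply/colP => j; rewrite !mxE; field.
exact: a0.
Qed.

(** A coefficient that vanishes in all relations spreads along [shift]: upwards from [k] to [M],
    then to 0, then from 0 to 1 and 2, and upwards again. Vertex 1 is excluded as a start because
    [shift u 1] mixes three coefficients. *)
Lemma near_relation_zero u k (Z : forall v, linear_relation M y v -> v k = 0) :
  (k <= M)%N -> k != 1%N -> linear_relation M y u -> forall i, (i <= M)%N -> u i = 0.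
Proof.
move=> kM k1.
(* Quantifying over all relations allows the property to be applied to shifted relations. *)
pose Zero k := forall v, linear_relation M y v -> v k = 0.
have step i : (1 < i)%N -> (i < M)%N -> Zero i -> Zero i.+1.
  move=> i1 iM Zi v /relation_shift/Zi; rewrite /shift (ltn_eqF iM).
  by case: i i1 {iM Zi} => [|[|i]].
have steps i j : (1 < i)%N -> (i <= j)%N -> (j <= M)%N -> Zero i -> Zero j.
  elim: j => [|j IH] i1 ij jM Zi; first by move: i1; rewrite (_ : i = 0%N)//; lia.
  move: ij; rewrite leq_eqVlt => /predU1P[<-//|ij].
  by apply: step; [lia|lia|apply: IH => //; lia].
have ZM : Zero M -> Zero 0.
  by move=> Zm v /relation_shift/Zm; rewrite /shift eqxx.
have Z0 : Zero 0.
  case: (posnP k) Z => [->//|k0] Z; apply/ZM/(steps k) => //; lia.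
have Z1 : Zero 1%N.
  move=> v rv; have := Z0 _ (relation_shift rv); rewrite /shift (ltn_eqF M0) /= (Z0 _ rv) mulr0 subr0.
  by move/eqP; rewrite mulf_eq0 invr_eq0 (negbTE a0) => /eqP.
have Z2 : Zero 2%N.
  move=> v rv; have := Z1 _ (relation_shift rv); rewrite /shift (ltn_eqF M1) /= (Z0 _ rv) (Z1 _ rv).
  by rewrite !(mulr0, subr0).
move=> ru [|[|i]] iM; [exact: Z0|exact: Z1|exact: (steps 2%N)].
Qed.

Let r := - (e / a).

(** When coefficient 1 always vanishes, [shift] multiplies coefficient 0 by [r], and [shift v 1 = 0]
    gives [v 2 = b * r * v 0]. Each further coefficient is read off the shifted relation. *)
Lemma near_relation_geometric (Z1 : forall v, linear_relation M y v -> v 1%N = 0) u :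
  linear_relation M y u ->
  forall i, (1 < i)%N -> (i <= M)%N -> u i = b * r ^+ i.-1 * u 0%N.
Proof.
have w0 v : linear_relation M y v -> shift v 0%N = r * v 0%N.
  by move=> rv; rewrite /shift (ltn_eqF M0)/= (Z1 _ rv) /r; field.
have w2 v : linear_relation M y v -> v 2%N = b * r * v 0%N.
  move=> rv; have := Z1 _ (relation_shift rv); rewrite /shift (ltn_eqF M1)/= (Z1 _ rv).
  by move=> /eqP; rewrite subr_eq0 => /eqP ->; rewrite /r; field.
move=> ru [//|[//|i]] _; elim: i u ru => [|i IH] u ru iM.
  by rewrite expr1 w2.
have := IH _ (relation_shift ru) (ltnW iM); rewrite w0// {1}/shift (ltn_eqF iM) /= => ->.
by rewrite [r ^+ i.+2]exprS; ring.
Qed.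

(** The geometric formula at [M] for the shifted relation closes the cycle, since
    [shift u M = u 0]. *)
Lemma near_relation_ratio (Z1 : forall v, linear_relation M y v -> v 1%N = 0) u :
  linear_relation M y u -> u 0%N != 0 -> b * r ^+ M = 1.
Proof.
move=> ru u0; have := near_relation_geometric Z1 (relation_shift ru) M1 (leqnn M).
rewrite {1}/shift eqxx {1}/shift (ltn_eqF M0)/= (Z1 _ ru) => E.
apply: (mulIf u0); rewrite mul1r [RHS]E -[in LHS](prednK M0) exprS /r; field.
exact: a0.
Qed.

(** The conjugate remains diagonal except on [y 0] and [y 1]. The off-diagonal terms there are what
    isolates vertices when memberships differ, and what must vanish for a plain shift of [I]. *)
Local Lemma conj_up I P : (forall i, (i <= M)%N -> P *m y i = (I i)%:R *: y i) ->
  [/\ A *m P *m A' *m y 1 = (I 0)%:R *: y 1 + (b / a * ((I 0)%:R - (I 1)%:R)) *: y 2,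
      A *m P *m A' *m y 0 = (I M)%:R *: (y 0 + e *: y 1)
        - e *: ((I 0)%:R *: y 1 + (b / a * ((I 0)%:R - (I 1)%:R)) *: y 2)
    & forall i, (0 < i)%N -> (i < M)%N -> A *m P *m A' *m y i.+1 = (I i)%:R *: y i.+1].
Proof.
move=> PI.
have Q1 : A *m P *m A' *m y 1 =
    (I 0)%:R *: y 1 + (b / a * ((I 0)%:R - (I 1)%:R)) *: y 2.
  rewrite -!mulmxA near_A'y1 -!scalemxAr !mulmxBr -!scalemxAr !PI// -!scalemxAr Ay0 Ay//.
  by apply/colP => j; rewrite !mxE; field.
split=> // [|i i0 iM]; last by rewrite -!mulmxA near_A'y// PI ?(ltnW iM)// -scalemxAr Ay.
rewrite -[in RHS]Q1 -!mulmxA near_A'y0 near_A'y1 !mulmxBr -!scalemxAr.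
rewrite PI// -scalemxAr AyM !mulmxBr -!scalemxAr.
by apply/colP => j; rewrite !mxE; field.
Qed.

(** For this conjugate the exceptional vertices are 0 and [M]. *)
Local Lemma conj_down I P : (forall i, (i <= M)%N -> P *m y i = (I i)%:R *: y i) ->
  [/\ A' *m P *m A *m y 0 = (I 1)%:R *: y 0 + (b * ((I 2)%:R - (I 1)%:R)) *: y 1,
      A' *m P *m A *m y M = (I 0)%:R *: y M
        + (e / a * ((I 1)%:R - (I 0)%:R)) *: (y 0 - b *: y 1)
    & forall i, (0 < i)%N -> (i < M)%N -> A' *m P *m A *m y i = (I i.+1)%:R *: y i].
Proof.
move=> PI; split=> [||i i0 iM].
- rewrite -!mulmxA Ay0 !mulmxDr -!scalemxAr !PI// -!scalemxAr near_A'y1 (@near_A'y 1)//.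
  by apply/colP => j; rewrite !mxE; field.
- rewrite -!mulmxA AyM !mulmxDr -!scalemxAr !PI// -!scalemxAr near_A'y1 near_A'y0.
  by apply/colP => j; rewrite !mxE; field.
by rewrite -!mulmxA Ay// PI// -scalemxAr near_A'y.
Qed.

Local Lemma near_up I : separator M y I -> ~~ I 0 -> ~~ I 1 -> ~~ I M ->
  separator M y (fun i => (0 < i)%N && I i.-1).
Proof.
move=> [P /conj_up[Q1 Q0 Q]] /negbTE I0 /negbTE I1 /negbTE IM; exists (A *m P *m A').
move=> [|[|i]] iM; last exact: Q.
  by rewrite Q0 I0 I1 IM !scale0r !(mulr0, subr0) !scale0r addr0 scaler0 subr0.
by rewrite Q1 /= I0 I1 subrr mulr0 !scale0r addr0.
Qed.

Local Lemma near_down I : separator M y I -> ~~ I 0 -> ~~ I 1 -> ~~ I 2 ->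
  separator M y (fun i => (i < M)%N && I i.+1).
Proof.
move=> [P /conj_down[Q0 QM Q]] /negbTE I0 /negbTE I1 /negbTE I2; exists (A' *m P *m A).
move=> i; rewrite leq_eqVlt => /predU1P[->|iM].
  by rewrite QM I0 I1 ltnn subrr mulr0 !scale0r addr0.
case: i iM => [|i] iM; last by rewrite Q// iM.
by rewrite Q0 I1 I2 subrr mulr0 !scale0r addr0 andbF scale0r.
Qed.

Local Lemma near_up_iter I k : separator M y I -> ~~ I 0 -> ~~ I 1 -> (k <= M)%N -> I k ->
  exists J, [/\ separator M y J, ~~ J 0, ~~ J 1 & J M].
Proof.
move=> + + + kM; move: {-2}(M - k)%N (erefl (M - k)%N) => d.
elim: d k I kM => [|d IH] k I kM dE sI I0 I1 Ik.
  by exists I; split=> //; have -> : M = k by lia.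
case: (boolP (I M)) => IM; first by exists I.
by apply: (IH k.+1 _ _ _ (near_up sI I0 I1 IM)) => //; lia.
Qed.

Local Lemma near_down_iter I k : separator M y I -> ~~ I 0 -> ~~ I 1 -> (k.+1 < M)%N ->
  I k.+2 -> exists J, [/\ separator M y J, ~~ J 0, ~~ J 1 & J 2].
Proof.
elim: k I => [|k IH] I sI I0 I1 kM Ik; first by exists I.
case: (boolP (I 2)) => I2; first by exists I.
apply: (IH _ (near_down sI I0 I1 I2)); rewrite ?(ltnW kM) ?kM //.
- by rewrite negb_and I1 orbT.
- by rewrite negb_and I2 orbT.
Qed.

(* The compressions [U] and [V] below send y 0 to b y 1 and to y 0 + e y 1,
   send y 1 to y 1 and to 0, and are diagonal with entries 0, 1 on the other
   vertices, so U V - (U V)^2 vanishes except at y 0. *)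
Local Lemma near_isolated0 I k : separator M y I -> ~~ I 0 -> ~~ I 1 -> (k <= M)%N -> I k ->
  isolated_vertex M y 0.
Proof.
move=> sI I0 I1 kM Ik.
have [J [[P PJ] J0 J1 JM]] := near_up_iter sI I0 I1 kM Ik.
have [L [[S SL] L0 L1 L2]] : exists J, [/\ separator M y J, ~~ J 0, ~~ J 1 & J 2].
  have k1 : (1 < k)%N by case: k kM Ik => [|[|]]//; [rewrite (negbTE I0)|rewrite (negbTE I1)].
  by apply: (near_down_iter (k := k.-2) sI I0 I1); case: k kM Ik k1 => [|[|]].
have := conj_up PJ; have := conj_down SL.
move: (A' *m S *m A) (A *m P *m A') => D C [T0 TM T] [Q1 Q0 Q].
move: J0 J1 L0 L1 Q1 Q0 T0 TM => /negbTE J0 /negbTE J1 /negbTE L0 /negbTE L1.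
rewrite J0 J1 JM L0 L1 L2 !(subrr, mulr0, scale0r, addr0, scaler0, subr0, scale1r, add0r, mulr1).
move=> Q1 Q0 T0 TM.
pose V := (1%:M - P) *m C *m (1%:M - P).
pose U := (1%:M - S) *m D *m (1%:M - S).
have cP i : (i <= M)%N -> (1%:M - P) *m y i = (~~ J i)%:R *: y i.
  by move=> iM; rewrite mulmxBl mul1mx PJ//; case: (J i); rewrite ?(scale0r, scale1r, subrr, subr0).
have cS i : (i <= M)%N -> (1%:M - S) *m y i = (~~ L i)%:R *: y i.
  by move=> iM; rewrite mulmxBl mul1mx SL//; case: (L i); rewrite ?(scale0r, scale1r, subrr, subr0).
have V0 : V *m y 0 = y 0 + e *: y 1.
  by rewrite /V -!mulmxA cP// J0 scale1r Q0 mulmxDr -scalemxAr !cP// J0 J1 !scale1r.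
have V1 : V *m y 1 = 0.
  by rewrite /V -!mulmxA cP// J1 scale1r Q1 mulmx0.
have Vi i : (0 < i)%N -> (i < M)%N -> V *m y i.+1 = (~~ J i.+1 && J i)%:R *: y i.+1.
  move=> i0 iM; rewrite /V -!mulmxA cP// -!scalemxAr Q// -!scalemxAr cP//.
  by case: (J i); case: (J i.+1); rewrite ?(scale0r, scaler0, scale1r).
have U0 : U *m y 0 = b *: y 1.
  by rewrite /U -!mulmxA cS// L0 scale1r T0 -scalemxAr !cS// L1 !scale1r.
have U1 : U *m y 1 = y 1.
  by rewrite /U -!mulmxA cS// L1 scale1r T// L2 scale1r cS// L1 scale1r.
have Ui i : (0 < i)%N -> (i <= M)%N -> exists c : bool, U *m y i = c%:R *: y i.
  move=> i0; rewrite leq_eqVlt => /predU1P[->|iM].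
    by exists false; rewrite /U -!mulmxA cS// -!scalemxAr TM !mulmx0 scaler0 scale0r.
  exists (~~ L i && L i.+1); rewrite /U -!mulmxA cS ?(ltnW iM)// -!scalemxAr T// -!scalemxAr cS ?(ltnW iM)//.
  by case: (L i); case: (L i.+1); rewrite ?(scale0r, scaler0, scale1r).
clearbody U V.
exists (U *m V - (U *m V) *m (U *m V)).
  (* Since [V] kills [y 1], the square of [U V] vanishes on [y 0]. Positivity of [b] and [e]
     prevents cancellation in [b + e]. *)
  have W0 : U *m (V *m y 0) = (b + e) *: y 1.
    by rewrite V0 mulmxDr -scalemxAr U0 U1 scalerDl.
  rewrite mulmxBl -!mulmxA W0 -!scalemxAr V1 mulmx0 scaler0 subr0 scaler_eq0.
  by rewrite negb_or yneq0// gt_eqF// addr_gt0.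
move=> [|[|i]]// iM _; first by rewrite mulmxBl -!mulmxA V1 !mulmx0 subrr.
have [c Uc] := Ui i.+2 isT iM.
rewrite mulmxBl -!mulmxA Vi// -!scalemxAr Uc -!scalemxAr Vi// -!scalemxAr Uc !scalerA.
by case: (~~ _ && _); case: c {Uc}; rewrite !(mulr0, mulr1, mul0r, scale0r, scale1r, subrr).
Qed.

(** An off-diagonal block of a conjugate of [P], taken between [P] and [1 - P], loses all diagonal
    entries. If [M] or 2 is in [I], a block of [A^-1 P A] retains one of the terms [y 0], [y 1] of
    the image of [y M]; otherwise a block of [A P A^-1] retains the [y 2]-term of the image of
    [y 1]. *)
Local Lemma near_split I : separator M y I -> ~~ I 0 -> I 1 ->
  isolated_vertex M y M \/ isolated_vertex M y 1.
Proof.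
move=> [P PI] /negbTE I0 I1.
have := conj_up PI; have := conj_down PI.
move: (A' *m P *m A) (A *m P *m A') => D C [T0 TM T] [Q1 Q0 Q].
have cP i : (i <= M)%N -> (1%:M - P) *m y i = (~~ I i)%:R *: y i.
  by move=> iM; rewrite mulmxBl mul1mx PI//; case: (I i); rewrite ?(scale0r, scale1r, subrr, subr0).
have ea : e / a != 0 by rewrite mulf_neq0 ?invr_eq0.
move: Q1 Q0 T0 TM.
rewrite I0 I1 !(mulr0, scale0r, addr0, scaler0, subr0, scale1r, add0r, mulr1, sub0r, mulrN1).
move=> Q1 Q0 T0 TM.
case: (boolP (I M)) => IM; [left|case: (boolP (I 2)) => I2; [left|right]].
- exists ((1%:M - P) *m D *m P).
    rewrite -!mulmxA PI// IM scale1r TM -scalemxAr mulmxBr -scalemxAr !cP// I0 I1.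
    by rewrite scale1r scale0r scaler0 subr0 scaler_eq0 negb_or ea yneq0.
  move=> i iM niM; have {niM}iM' : (i < M)%N by rewrite ltn_neqAle niM.
  rewrite -!mulmxA PI// -!scalemxAr; case: i iM iM' => [|i] iM iM'.
    by rewrite I0 scale0r.
  rewrite T// -!scalemxAr cP//.
  by case: (I i.+1); rewrite ?(scale0r, scaler0).
- exists (P *m D *m (1%:M - P)).
    rewrite -!mulmxA cP// IM scale1r TM -scalemxAr mulmxBr -scalemxAr !PI// I0 I1.
    by rewrite scale1r scale0r sub0r scaler_eq0 negb_or ea oppr_eq0 scaler_eq0 negb_or b0 yneq0.
  move=> i iM niM; have {niM}iM' : (i < M)%N by rewrite ltn_neqAle niM.
  rewrite -!mulmxA cP// -!scalemxAr; case: i iM iM' => [|i] iM iM'.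
    by rewrite T0 I2 subrr mulr0 scale0r addr0 PI// I0 scale0r scaler0.
  rewrite T// -!scalemxAr PI//.
  by case: (I i.+1); rewrite ?(scale0r, scaler0).
exists ((1%:M - P) *m C *m P).
  rewrite -!mulmxA PI// I1 scale1r Q1 -scalemxAr cP// I2 scale1r.
  by rewrite scaler_eq0 oppr_eq0 mulf_eq0 invr_eq0 !negb_or a0 b0 yneq0.
move=> [|[|i]]// iM _; rewrite -!mulmxA PI//; first by rewrite I0 scale0r !mulmx0.
rewrite -!scalemxAr Q// -!scalemxAr cP//.
by case: (I i.+2); rewrite ?(scale0r, scaler0).
Qed.

(** A nontrivial relation rules out isolation of every vertex but 1, by [near_relation_zero]. After
    complementing so that 0 is outside, each of the two cases for vertex 1 isolates some vertex, and
    only 1 is possible. *)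
Lemma near_separator I u : separator M y I -> linear_relation M y u ->
  (exists2 k, (k <= M)%N & u k != 0) ->
  (exists2 k, (k <= M)%N & I k != I 0) -> isolated_vertex M y 1.
Proof.
move=> sI ru [l lM ul] [k kM Ik].
have niso i : (i <= M)%N -> i != 1%N -> ~ isolated_vertex M y i.
  move=> iM i1 iso; move: ul; rewrite (near_relation_zero _ iM i1 ru) ?eqxx// => v.
  exact: isolated_relation0.
have [J [sJ J0 [j jM Jj]]] : exists J, [/\ separator M y J, ~~ J 0 & exists2 k, (k <= M)%N & J k].
  case I0: (I 0); last by exists I; split; rewrite ?I0//; exists k => //; move: Ik; rewrite I0; case: (I k).
  exists (fun i => ~~ I i); split; [exact: separatorC|by rewrite I0|exists k => //].
  by move: Ik; rewrite I0; case: (I k).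
case: (boolP (J 1)) => J1; last by have := niso 0 isT isT (near_isolated0 sJ J0 J1 jM Jj).
have [iso|//] := near_split sJ J0 J1.
by have := niso M (leqnn M) _ iso; rewrite gtn_eqF// => /(_ isT).
Qed.

End NearWielandt.

(** * Convex cones and Minkowski's theorem *)

Section ConvexCones.
Context {R : realType} {n : nat}.
Local Notation V := 'cV[R]_n.
Implicit Types (K F : set V) (x y z : V).

Lemma lin_continuous (f : {linear V -> R^o}) : continuous f.
Proof.
have -> : (f : V -> R) = fun x => \sum_(i < n) x i 0 * f (delta_mx i 0).
  apply/funext => x; rewrite {1}[x]matrix_sum_delta linear_sum; apply: eq_bigr => i _.
  by rewrite linear_sum big_ord1 linearZ.
apply: continuous_big; first exact: add_continuous.
move=> i _ x; apply: (@continuousM R V (fun x : V => x i 0) (cst (f (delta_mx i 0)))).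
  exact: coord_continuous.
exact: cst_continuous.
Qed.

Lemma closed_line K x y : closed K -> closed [set t : R | K (x + t *: y)].
Proof.
move=> cK; apply: (@closed_comp _ _ (fun t : R => x + t *: y) K) => // t _.
by apply: cvgD; [exact: cvg_cst|apply: cvgZl].
Qed.

Lemma cone0 K : convex_cone K -> K 0. Proof. by case. Qed.
Lemma coneD K x y : convex_cone K -> K x -> K y -> K (x + y).
Proof. by case=> _ + _; apply. Qed.
Lemma coneZ K a x : convex_cone K -> 0 <= a -> K x -> K (a *: x).
Proof. by case=> _ _; apply. Qed.
Lemma cone_sum K (I : Type) (r : seq I) (P : pred I) (f : I -> V) :
  convex_cone K -> (forall i, P i -> K (f i)) -> K (\sum_(i <- r | P i) f i).
Proof. by move=> [K0 KD _] Kf; apply: big_ind. Qed.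

Lemma coneZr K a x : convex_cone K -> 0 < a -> K (a *: x) -> K x.
Proof.
move=> cK a0 Kax; rewrite -[x]scale1r -(mulVf (lt0r_neq0 a0)) -scalerA.
by apply: coneZ => //; rewrite invr_ge0 ltW.
Qed.

Lemma Phi_min K F x y : face K F -> F x -> Phi K x y -> F y.
Proof. by move=> fF Fx xy; apply: (xy F (conj fF _)) => _ ->. Qed.

(** The right-hand side defines a face containing [x], and every face containing [x] contains it.
    This replaces the intersection of faces by an order condition. *)
Lemma PhiP K x y : convex_cone K -> K x ->
  Phi K x y <-> K y /\ exists2 t : R, 0 < t & K (x - t *: y).
Proof.
move=> cK Kx; split; last first.
  move=> [Ky [t t0 Kxy]] F [[cF _ fF] Fx].
  by apply: (coneZr cF t0); apply: (fF x) => //; [apply: Fx|apply: coneZ => //; exact: ltW].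
move=> /(_ [set y | K y /\ exists2 t : R, 0 < t & K (x - t *: y)]); apply; split; last first.
  by move=> _ ->; split=> //; exists 1 => //; rewrite scale1r subrr; exact: cone0.
split.
- split=> [|u v [Ku [s s0 Ks]] [Kv [t t0 Kt]]|a u a0 [Ku [s s0 Ks]]].
  + by split; [exact: cone0|exists 1 => //; rewrite scaler0 subr0].
  + split; first exact: coneD.
    have st : 0 < s + t by rewrite addr_gt0.
    (* With this constant the difference is a convex combination of [x - s *: u] and
       [x - t *: v]. *)
    exists (s * t / (s + t)); first by rewrite divr_gt0 ?mulr_gt0.
    have -> : x - (s * t / (s + t)) *: (u + v) =
       (t / (s + t)) *: (x - s *: u) + (s / (s + t)) *: (x - t *: v).
      by apply/colP => i; rewrite !mxE; field; rewrite gt_eqF.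
    by apply: coneD => //; apply: coneZ => //; rewrite divr_ge0 ?ltW.
  + split; first exact: coneZ.
    move: a0; rewrite le_eqVlt => /predU1P[<-|a0].
      by exists 1 => //; rewrite scale0r scaler0 subr0.
    by exists (s / a); [rewrite divr_gt0|rewrite scalerA divfK ?gt_eqF].
- by move=> u [].
- move=> u v [Ku [s s0 Ks]] Kv Kuv; split=> //; exists s => //.
  have -> : x - s *: v = (x - s *: u) + s *: (u - v).
    by apply/colP => i; rewrite !mxE; ring.
  by apply: coneD => //; apply: coneZ => //; exact: ltW.
Qed.

Lemma Phi_id K x : convex_cone K -> K x -> Phi K x x.
Proof. by move=> cK Kx F [_]; apply. Qed.

Lemma Phi_sub K x y : convex_cone K -> K x -> Phi K x y -> Phi K y `<=` Phi K x.
Proof. by move=> cK Kx xy z zy F [fF xF]; exact: (Phi_min fF (xy F (conj fF xF)) zy). Qed.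

Lemma Phi_cone K x : convex_cone K -> convex_cone (Phi K x).
Proof.
move=> cK; split=> [F [[cF _ _] _]|u v Fu Fv F [fF xF]|a u a0 Fu F [fF xF]].
- exact: cone0.
- have [cF _ _] := fF; by apply: coneD; [|exact: (Fu F (conj fF xF))|exact: (Fv F (conj fF xF))].
- have [cF _ _] := fF; by apply: coneZ => //; exact: (Fu F (conj fF xF)).
Qed.

Lemma PhiZ K a x : convex_cone K -> K x -> 0 < a -> Phi K (a *: x) = Phi K x.
Proof.
move=> cK Kx a0; have Kax : K (a *: x) by apply: coneZ => //; exact: ltW.
apply/seteqP; split; apply: Phi_sub => //.
  exact: (coneZ (Phi_cone x cK) (ltW a0) (Phi_id cK Kx)).
exact: (coneZr (Phi_cone (a *: x) cK) a0 (Phi_id cK Kax)).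
Qed.

Lemma rayZ a x : 0 < a -> ray (a *: x) = ray x.
Proof.
move=> a0; apply/seteqP; split=> _ [c /= c0 <-].
  by exists (c * a); rewrite ?scalerA //= mulr_ge0 // ltW.
by exists (c / a); rewrite /= ?scalerA ?divfK ?gt_eqF// divr_ge0 // ltW.
Qed.

Lemma extremeZ K a x : convex_cone K -> 0 < a ->
  extreme_vector K x -> extreme_vector K (a *: x).
Proof.
move=> cK a0 [Kx x0 Px]; split; first by apply: coneZ => //; exact: ltW.
  by rewrite scaler_eq0 gt_eqF.
by rewrite PhiZ// Px rayZ.
Qed.

Lemma pointed0 K x : pointed_cone K -> K x -> K (- x) -> x = 0.
Proof. by move=> pK Kx KNx; have : (K `&` [set x | K (- x)]) x by []; rewrite pK. Qed.

Lemma extreme_summand K x y : convex_cone K -> extreme_vector K x ->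
  K y -> K (x - y) -> exists2 a : R, 0 <= a & y = a *: x.
Proof.
move=> cK [Kx x0 Px] Ky Kxy; have : Phi K x y.
  by apply/PhiP => //; split=> //; exists 1; rewrite ?scale1r.
by rewrite Px => -[a a0 <-]; exists a.
Qed.

(** Only the sign of the multiple has to be settled: a negative one would put both [y] and [- y] in
    [K]. *)
Lemma extremeI K x : convex_cone K -> pointed_cone K -> K x -> x != 0 ->
  (forall y, Phi K x y -> exists a : R, y = a *: x) -> extreme_vector K x.
Proof.
move=> cK pK Kx x0 H; split=> //; apply/seteqP; split=> [y xy|_ [a a0 <-]]; last first.
  exact: (coneZ (Phi_cone x cK) a0 (Phi_id cK Kx)).
have [a E] := H _ xy; exists a => //=; rewrite leNgt; apply/negP => a0.
have /PhiP[//|//|Ky _] := xy.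
move/eqP: x0; apply; apply: (pointed0 pK) => //.
apply: (@coneZr _ (- a)) => //; first by rewrite oppr_gt0.
by rewrite scalerN scaleNr opprK -E.
Qed.

(** A finite family in [F] of maximal rank spans [lspan F]; the coordinates of [x] in it are then
    sorted by sign. *)
Lemma lspan_cone F x : convex_cone F -> x \in lspan F ->
  exists y z, [/\ F y, F z & x = y - z].
Proof.
move=> cF xF.
pose P d := `[< exists2 s : seq V, (forall v, v \in s -> F v) & \dim (span s) = d >].
have exP : exists d, P d.
  by exists 0%N; apply/asboolP; exists nil => //; rewrite span_nil dimv0.
have ubP d : P d -> (d <= \dim {:V})%N.
  by move=> /asboolP[s _ <-]; apply: dimvS; exact: subvf.
case: (ex_maxnP exP ubP) => d /asboolP[s sF sd] dmax.
have Fs : F `<=` [set` span s].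
  move=> v Fv /=.
  have ss : ((span s) <= (span (v :: s)))%VS by rewrite span_cons addvSr.
  have : (\dim (span (v :: s)) <= \dim (span s))%N.
    rewrite sd; apply: dmax; apply/asboolP; exists (v :: s) => // w.
    by rewrite inE => /predU1P[->//|/sF].
  by move=> dd; have /eqP -> : (span s) == span (v :: s); [rewrite eqEdim ss|rewrite memv_span ?mem_head].
have /subvP/(_ _ xF) /(@coord_span _ _ _ (in_tuple s)) -> := lspan_min Fs.
apply: (big_ind (fun x => exists y z, [/\ F y, F z & x = y - z])).
- by exists 0, 0; split; [exact: cone0|exact: cone0|rewrite subrr].
- move=> _ _ [u [v [Fu Fv ->]]] [u' [v' [Fu' Fv' ->]]]; exists (u + u'), (v + v').
  by split; [exact: coneD|exact: coneD|rewrite opprD addrACA].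
- move=> i _; have Fi : F (s`_i) by apply: sF; exact: mem_nth.
  move: (coord _ _ _) => c; case: (leP 0 c) => c0.
    by exists (c *: s`_i), 0; split; [exact: coneZ|exact: cone0|rewrite subr0].
  exists 0, ((- c) *: s`_i); split; [exact: cone0| |by rewrite scaleNr sub0r opprK].
  by apply: coneZ => //; rewrite oppr_ge0 ltW.
Qed.

Lemma lspanS F G : F `<=` G -> (lspan F <= lspan G)%VS.
Proof. by move=> FG; apply: lspan_min => x /FG; exact: sub_lspan. Qed.

(** The exit point is the last point of [K] on the half-line from [x] in direction [- y]. *)
Lemma cone_exit K x y : closed K -> convex_cone K -> pointed_cone K -> K x ->
  Phi K x y -> y != 0 ->
  exists2 t : R, 0 < t & K (x - t *: y) /\
    (\dim (lspan (Phi K (x - t *: y))) < \dim (lspan (Phi K x)))%N.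
Proof.
move=> clK cK pK Kx xy y0; have /PhiP[//|//|Ky [t0 t0_gt0 Kt0]] := xy.
pose T := [set t : R | K (x + t *: - y)].
have clT : closed T by exact: closed_line.
have Tt0 : T t0 by rewrite /T /= scalerN.
(* If the half-line never left [K], then [- y + t^-1 *: x] would lie in [K] for arbitrarily large
   [t], hence so would the limit [- y], against pointedness. *)
have ubT : has_ubound T.
  apply: contrapT => nub; move/eqP: y0; apply; apply: (pointed0 pK) => //.
  have : closed [set t : R | K (- y + t *: x)] by exact: closed_line.
  move=> /(_ 0); rewrite /= scale0r addr0; apply => U /nbhs_ballP[e /= e0 eU].
  have [t Tt te] : exists2 t, T t & e^-1 < t.
    apply: contrapT => nT; apply: nub; exists e^-1 => t Tt; rewrite leNgt; apply/negP => lt.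
    by apply: nT; exists t.
  have tp : 0 < t by rewrite (lt_trans _ te) // invr_gt0.
  exists t^-1; split.
    rewrite /=; have -> : - y + t^-1 *: x = t^-1 *: (x + t *: - y).
      by rewrite scalerDr scalerA mulVf ?gt_eqF// scale1r addrC.
    by apply: coneZ => //; rewrite invr_ge0 ltW.
  apply: eU; rewrite /ball /= sub0r normrN gtr0_norm ?invr_gt0//.
  by rewrite invf_plt// posrE.
have T0 : T !=set0 by exists t0.
have Ts : T (sup T) by exact/clT/closure_sup.
have s0 : 0 < sup T by rewrite (lt_le_trans t0_gt0)// ub_le_sup.
have Kz : K (x - sup T *: y) by move: Ts; rewrite /T /= scalerN.
exists (sup T) => //; split=> //.
have zx : Phi K (x - sup T *: y) `<=` Phi K x.
  apply: Phi_sub => //; apply/PhiP => //; split => //; exists 1 => //.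
  by rewrite scale1r opprB addrC subrK; apply: coneZ => //; exact: ltW.
(* Without a drop, [y] would be a difference [u - v] of points in the face of the exit point.
   Subtracting a little of [u] and adding as much of [v] would then move beyond the supremum. *)
rewrite ltnNge; apply/negP => dd.
have E : lspan (Phi K (x - sup T *: y)) = lspan (Phi K x).
  by apply/eqP; rewrite eqEdim lspanS.
have : y \in lspan (Phi K (x - sup T *: y)) by rewrite E; exact: sub_lspan.
move=> /lspan_cone[|u [v [/PhiP[//|//|Ku [t tp Kt]] /PhiP[//|//|Kv _] yE]]]; first exact: Phi_cone.
have : T (sup T + t).
  rewrite /T /=; have -> : x + (sup T + t) *: - y = (x - sup T *: y - t *: u) + t *: v.
    by rewrite yE; apply/colP => i; rewrite !mxE; ring.
  by apply: coneD => //; apply: coneZ => //; exact: ltW.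
by move/(ub_le_sup ubT); rewrite gerDl leNgt tp.
Qed.

(* Minkowski's theorem, by induction on the dimension of the span of [Phi K x]:
   leaving the cone from [x] along any direction of [Phi K x] drops it. *)
Lemma extreme_decomposition K x : closed K -> convex_cone K -> pointed_cone K -> K x ->
  exists2 s : seq V, (forall v, v \in s -> extreme_vector K v) & x = \sum_(v <- s) v.
Proof.
move=> clK cK pK; have [d] := ubnP (\dim (lspan (Phi K x))); elim: d x => // d IH x dx Kx.
have [->|x0] := eqVneq x 0; first by exists nil; rewrite ?big_nil.
have descend e : Phi K x e -> e != 0 -> exists t : R, exists s : seq V, [/\ 0 < t,
    forall v, v \in s -> extreme_vector K v & x = t *: e + \sum_(v <- s) v].
  move=> xe e0; have [t t0 [Kz dz]] := cone_exit clK cK pK Kx xe e0.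
  have [s sK zs] := IH (x - t *: e) (leq_trans dz (dx : (_ <= d)%N)) Kz.
  by exists t, s; split=> //; rewrite -zs addrC subrK.
(* One extreme vector in the face of [x] is enough: descending along it leaves a sum of extreme
   vectors. *)
suff [e [xe ee]] : exists e, Phi K x e /\ extreme_vector K e.
  have e0 : e != 0 by have [_ e0 _] := ee.
  have [t [s [t0 sK ->]]] := descend e xe e0.
  exists (t *: e :: s); last by rewrite big_cons.
  by move=> v; rewrite inE => /predU1P[->|/sK//]; exact: extremeZ.
have [xe|] := pselect (extreme_vector K x); first by exists x; split=> //; exact: Phi_id.
(* Descending along a direction not proportional to [x] leaves a nonempty sum, whose first term is
   an extreme vector in the face of [x]. *)
move=> nxe; have [y xy yx] : exists2 y, Phi K x y & forall a : R, y <> a *: x.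
  apply: contrapT => H; apply: nxe; apply: extremeI => // y xy.
  by apply: contrapT => H'; apply: H; exists y => // a ya; apply: H'; exists a.
have y0 : y != 0 by apply/eqP => yE; apply: (yx 0); rewrite scale0r.
have [t [[|v s] [t0 sK xE]]] := descend y xy y0.
  exfalso; apply: (yx t^-1); rewrite xE big_nil addr0 scalerA mulVf ?scale1r //.
  by rewrite gt_eqF.
have ev : extreme_vector K v by apply: sK; exact: mem_head.
exists v; split => //; apply/PhiP => //; split; first by case: ev.
exists 1 => //.
have -> : x - 1 *: v = t *: y + \sum_(w <- s) w.
  by rewrite xE big_cons scale1r addrA addrAC addrK.
apply: coneD => //; first by apply: coneZ; [|exact: ltW|have /PhiP[] := xy].
rewrite big_seq; apply: cone_sum => // w ws.
by have [] : extreme_vector K w by apply: sK; rewrite inE ws orbT.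
Qed.

(** A small displacement within the span has small coordinates, so adding them to the [c i] leaves
    these nonnegative. *)
Lemma relint_combination K m (X : m.-tuple V) (c : 'I_m -> R) :
  convex_cone K -> (forall i : 'I_m, K X`_i) -> (forall i, 0 < c i) ->
  \forall y \near (\sum_(i < m) c i *: X`_i : V), y \in span X -> K y.
Proof.
move=> cK KX c0; set y0 : V := \sum_(i < m) _.
(* Coordinates are taken of [y - y0] rather than of [y]: [X] may be dependent, so those of [y0] need
   not be the [c i]. *)
have H i : \forall y \near y0, - c i < coord X i (y - y0).
  have cf : {for y0, continuous (coord X i : {linear V -> R^o})} by exact: lin_continuous.
  have : \forall y \near y0, coord X i y0 - c i < coord X i y.
    by apply: (cvgr_gt (coord X i y0 : R) cf); rewrite gtrBl.
  by apply: filterS => y; rewrite linearB /= => h; rewrite ltrBrDl.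
have Hall := @filter_forall V _ (fun i => [set y : V | - c i < coord X i (y - y0)]) (nbhs y0)
  (nbhs_filter (y0 : V)) H.
apply: (@filterS V (nbhs y0) (nbhs_filter (y0 : V)) _ _ _ Hall) => y yc yX.
have y0X : y0 \in span X.
  by apply: memv_suml => i _; rewrite memvZ// memv_span// mem_nth// size_tuple.
rewrite -[y](subrK y0) {1}(coord_span (memvB yX y0X)) -big_split /=.
apply: cone_sum => // i _; rewrite -scalerDl; apply: coneZ => //.
by rewrite -lerBlDr sub0r; exact/ltW/yc.
Qed.

End ConvexCones.

(** * Cones with labelled extreme vectors: generation, arcs and interior *)

Section GeneratedCones.
Context {R : realType} {n m : nat}.
Local Notation V := 'cV[R]_n.
Variables (K : set V) (x : 'I_m -> V).
Hypotheses (clK : closed K) (cK : convex_cone K) (pK : pointed_cone K).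
Hypothesis xK : extreme_labelling K x.

Lemma labelling_extreme i : extreme_vector K (x i). Proof. by have [[]] := xK. Qed.

Lemma labelling_cone i : K (x i). Proof. by have [] := labelling_extreme i. Qed.

Lemma labelling_neq0 i : x i != 0. Proof. by have [] := labelling_extreme i. Qed.

Lemma labelling_distinct i j (a : R) : x i = a *: x j -> i = j.
Proof. by move=> xij; apply: contrapT => ij; have [[_ H] _] := xK; apply: (H _ _ ij); exists a. Qed.

Lemma labelling_extreme_multiple y : extreme_vector K y ->
  exists i (a : R), 0 < a /\ y = a *: x i.
Proof.
move=> ey; have [Ky y0 Py] := ey; have [_ /(_ _ ey)[i Pi]] := xK.
have := Phi_id cK Ky; rewrite Pi; have [_ _ ->] := labelling_extreme i.
move=> [a /= a0 E]; exists i, a; split=> //; rewrite lt_neqAle a0 andbT.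
by apply: contra_neq y0 => a0'; rewrite -E -a0' scale0r.
Qed.

Lemma labelling_generates y : K y ->
  exists2 c : 'I_m -> R, (forall i, 0 <= c i) & y = \sum_i c i *: x i.
Proof.
move=> /(extreme_decomposition clK cK pK)[s + ->]; elim: s => [_|v s IH sK].
  by exists (fun=> 0) => //; rewrite big_nil big1// => i _; rewrite scale0r.
have [|c c0 sE] := IH; first by move=> w ws; apply: sK; rewrite inE ws orbT.
have [i [a [a0 vE]]] := labelling_extreme_multiple (sK _ (mem_head _ _)).
exists (fun j => c j + (j == i)%:R * a) => [j|].
  by rewrite addr_ge0// mulr_ge0// ltW.
rewrite big_cons sE vE addrC; under [RHS]eq_bigr do rewrite scalerDl.
rewrite big_split /=; congr (_ + _); rewrite (bigD1 i)//= eqxx mul1r big1 ?addr0//.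
by move=> j /negbTE ->; rewrite mul0r scale0r.
Qed.

Lemma cone_comb (c : 'I_m -> R) : (forall i, 0 <= c i) -> K (\sum_i c i *: x i).
Proof. by move=> c0; apply: cone_sum => // i _; apply: coneZ => //; exact: labelling_cone. Qed.

Lemma labelling_arc_multiple i j (a t : R) : 0 < t -> 0 <= a -> K (a *: x i - t *: x j) -> j = i.
Proof.
move=> t0; rewrite le_eqVlt => /predU1P[<-|a0] Ka.
  have := labelling_neq0 j; suff -> : x j = 0 by rewrite eqxx.
  apply: (pointed0 pK); [exact: labelling_cone|apply: (coneZr cK t0)].
  by rewrite scalerN; move: Ka; rewrite scale0r sub0r.
have := extremeZ cK a0 (labelling_extreme i).
move=> /(extreme_summand cK) /(_ (coneZ cK (ltW t0) (labelling_cone j)) Ka)[b b0 E].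
apply: (@labelling_distinct _ _ (t^-1 * (b * a))).
by rewrite -scalerA -scalerA -E scalerA mulVf ?gt_eqF// scale1r.
Qed.

Section Arcs.
Variable A : 'M[R]_n.
Hypothesis AK : cone_nonneg K A.

(** Both faces are those of representatives, so by [PhiP] an arc becomes domination of a positive
    multiple of [x j] by [A *m x i]. *)
Lemma cone_arcP i j : cone_arc K A (Phi K (x i)) (Phi K (x j)) <->
  exists2 t : R, 0 < t & K (A *m x i - t *: x j).
Proof.
split.
  move=> [u [v [eu ev Pu Pv PvAu]]].
  have [i' [a [a0 uE]]] := labelling_extreme_multiple eu.
  have [j' [b [b0 vE]]] := labelling_extreme_multiple ev.
  have Ku := labelling_cone i; have Kv := labelling_cone j.
  have /PhiP : Phi K v (x j) by rewrite -Pv; exact: Phi_id.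
  have Ku' : K u by case: eu.
  move: PvAu; rewrite -Pv => /(_ _ (Phi_id cK Kv)) /PhiP.
  move=> /(_ cK (AK Ku'))[_ [t t0 Kt]] _.
  have /PhiP : Phi K (x i) u by rewrite Pu; exact: Phi_id.
  move=> /(_ cK Ku)[_ [s s0 Ks]].
  exists (s * t); first by rewrite mulr_gt0.
  have -> : A *m x i - (s * t) *: x j = A *m (x i - s *: u) + s *: (A *m u - t *: x j).
    by rewrite mulmxBr -scalemxAr scalerBr scalerA addrA subrK.
  by apply: coneD => //; [exact: AK|apply: coneZ => //; exact: ltW].
move=> [t t0 Kt]; exists (x i), (x j); split=> //; try exact: labelling_extreme.
apply: Phi_sub => //; first by apply: AK; exact: labelling_cone.
apply/PhiP => //; first by apply: AK; exact: labelling_cone.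
by split; [exact: labelling_cone|exists t].
Qed.

Variable e : rel 'I_m.
Hypothesis Ae : digraph_given_by K A x e.

(** The [x j] may be dependent, but any nonnegative expression of [A *m x i] is supported on
    successors, since a positive coefficient is itself an arc. *)
Lemma digraph_comb i : exists c : 'I_m -> R, [/\ forall j, 0 <= c j,
  A *m x i = \sum_j c j *: x j & forall j, ~~ e i j -> c j = 0].
Proof.
have [c c0 E] := labelling_generates (AK (labelling_cone i)).
exists c; split=> // j eij; apply/eqP; rewrite -[_ == _]negbK; apply/negP => cj0.
have cj : 0 < c j by rewrite lt_neqAle eq_sym cj0 c0.
move/negP: eij; apply; apply/Ae/cone_arcP; exists (c j) => //.
rewrite E (bigD1 j)//= addrC addrK; apply: cone_sum => // k _.
by apply: coneZ => //; exact: labelling_cone.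
Qed.

Lemma digraph_single i j : (forall k, e i k = (k == j)) ->
  exists2 a : R, 0 < a & A *m x i = a *: x j.
Proof.
move=> eij; have [c [c0 E Z]] := digraph_comb i.
have {}E : A *m x i = c j *: x j.
  by rewrite E (bigD1 j)//= big1 ?addr0// => k kj; rewrite Z ?scale0r// eij.
exists (c j) => //; rewrite lt_neqAle c0 andbT; apply/eqP => cj.
have /Ae/cone_arcP[t t0] : e i j by rewrite eij.
rewrite E -cj scale0r sub0r => Kt; have := labelling_neq0 j.
suff -> : x j = 0 by rewrite eqxx.
apply: (pointed0 pK); [exact: labelling_cone|apply: (coneZr cK t0)].
by rewrite scalerN.
Qed.

(** If one coefficient were zero, [A *m x i] would be a multiple of a single extreme vector, and the
    arc to the other would contradict [labelling_arc_multiple]. *)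
Lemma digraph_double i j l : j != l -> (forall k, e i k = (k == j) || (k == l)) ->
  exists a b : R, [/\ 0 < a, 0 < b & A *m x i = a *: x j + b *: x l].
Proof.
move=> jl eij; have [c [c0 E Z]] := digraph_comb i.
have {}E : A *m x i = c j *: x j + c l *: x l.
  rewrite E (bigD1 j)//= (bigD1 l) 1?eq_sym//= big1 ?addr0// => k /andP[kj kl].
  by rewrite Z ?scale0r// eij negb_or kj.
have /Ae/cone_arcP[t t0 Kt] : e i j by rewrite eij eqxx.
have /Ae/cone_arcP[s s0 Ks] : e i l by rewrite eij eqxx orbT.
move: Kt Ks; rewrite E => Kt Ks.
exists (c j), (c l); split=> //; rewrite lt_neqAle c0 andbT; apply/eqP => cE.
  move: Kt; rewrite -cE scale0r add0r => /(labelling_arc_multiple t0 (c0 l)) /eqP.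
  by rewrite (negbTE jl).
move: Ks; rewrite -cE scale0r addr0 => /(labelling_arc_multiple s0 (c0 j)) /eqP.
by rewrite eq_sym (negbTE jl).
Qed.

End Arcs.

Section Interior.
Hypothesis Kfull : lspan K = fullv.

Lemma labelling_span : (span [tuple x i | i < m] = fullv)%VS.
Proof.
apply/eqP; rewrite eqEsubv subvf /= -Kfull; apply/lspan_min => y Ky /=.
have [c _ ->] := labelling_generates Ky; apply: memv_suml => i _.
by rewrite memvZ// memv_span//; apply/mapP; exists i; rewrite ?mem_enum.
Qed.

Lemma interior_combination k (y : 'I_k -> V) (c : 'I_k -> R) :
  (forall i, K (y i)) -> (forall i, 0 < c i) -> span [tuple y i | i < k] = fullv ->
  K° (\sum_i c i *: y i).
Proof.
move=> Ky c0 yf.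
have Ky' (i : 'I_k) : K [tuple y i | i < k]`_i by rewrite -tnth_nth tnth_mktuple.
have := relint_combination cK Ky' c0; rewrite yf.
under eq_bigr do rewrite -tnth_nth tnth_mktuple.
by apply: filterS => z; rewrite memvf => /(_ isT).
Qed.

Lemma interior_line y z : K° y -> exists2 t : R, 0 < t & K (y - t *: z).
Proof.
move=> Ky.
have cf : {for 0, continuous (fun t : R => y + t *: - z)}.
  by apply: cvgD; [exact: cvg_cst|apply: cvgZl].
have : \forall t \near (0 : R), K (y + t *: - z).
  by apply: cf; rewrite scale0r addr0.
move=> /nbhs_ballP[e /= e0 eK]; exists (e / 2); first by rewrite divr_gt0.
rewrite -scalerN; apply: eK; rewrite /ball /= sub0r normrN gtr0_norm ?divr_gt0//.
by rewrite ltr_pdivrMr// mulr_natr mulr2n ltrDl.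
Qed.

Lemma interiorP y : K° y <-> exists2 c : 'I_m -> R, (forall i, 0 < c i) & y = \sum_i c i *: x i.
Proof.
split=> [Ky|[c c0 ->]]; last first.
  by apply: interior_combination => //; [exact: labelling_cone|exact: labelling_span].
(* Subtracting a small multiple of the sum of all [x i] stays in [K]; adding it back makes every
   coefficient positive. *)
have [t t0 /labelling_generates[c c0 E]] := interior_line (\sum_i x i) Ky.
exists (fun i => c i + t) => [i|]; first by rewrite ltr_wpDl.
under eq_bigr do rewrite scalerDl.
by rewrite big_split /= -E -scaler_sumr subrK.
Qed.

Lemma interiorD y z : K° y -> K z -> K° (y + z).
Proof.
move=> /interiorP[c c0 ->] /labelling_generates[d d0 ->]; apply/interiorP.
exists (fun i => c i + d i) => [i|]; first by rewrite ltr_pwDl.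
by rewrite -big_split; apply: eq_bigr => i _; rewrite scalerDl.
Qed.

Lemma interiorZ a y : 0 < a -> K° y -> K° (a *: y).
Proof.
move=> a0 /interiorP[c c0 ->]; apply/interiorP.
exists (fun i => a * c i) => [i|]; first by rewrite mulr_gt0.
by rewrite scaler_sumr; apply: eq_bigr => i _; rewrite scalerA.
Qed.


Lemma interiorZr a y : 0 < a -> K° (a *: y) -> K° y.
Proof.
move=> a0 /(interiorZ (a := a^-1)); rewrite scalerA mulVf ?gt_eqF// scale1r; apply.
by rewrite invr_gt0.
Qed.

(** The vectors [A *m x i] still span because [A] is invertible, so their positive combinations are
    interior. *)
Lemma interior_mulmx A y : cone_nonneg K A -> A \in unitmx -> K° y -> K° (A *m y).
Proof.
move=> AK Au /interiorP[c c0 ->]; rewrite mulmx_sumr.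
under eq_bigr do rewrite -scalemxAr.
apply: (@interior_combination _ (fun i => A *m x i)) => //.
  by move=> i; apply: AK; exact: labelling_cone.
apply/eqP; rewrite eqEsubv subvf /=; apply/subvP => z _.
have : invmx A *m z \in span [tuple x i | i < m] by rewrite labelling_span memvf.
move=> /(coord_span); move: (coord _) => c' /(congr1 (mulmx A)).
rewrite mulmxA mulmxV// mul1mx => ->; rewrite mulmx_sumr; apply: memv_suml => i _.
rewrite -scalemxAr memvZ// memv_span// -tnth_nth tnth_mktuple.
by apply/mapP; exists i; rewrite ?mem_enum.
Qed.

End Interior.
End GeneratedCones.

(** * Cyclic vectors and exponents *)

Section CyclicVector.
Context {F : fieldType} {n M : nat} (A : 'M[F]_n.+1) (v : 'cV[F]_n.+1) (c d : F).
Hypothesis Av_span : forall w : 'cV[F]_n.+1,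
  exists u : nat -> F, w = \sum_(k < M.+1) u k *: (A ^+ k *m v).
Hypothesis Av_top : A ^+ M.+1 *m v = c *: (A *m v) + d *: v.

Lemma mulmx_expr k (B : 'M[F]_n.+1) (w : 'cV[F]_n.+1) : B ^+ k.+1 *m w = B *m (B ^+ k *m w).
Proof. by rewrite mulmxA exprS. Qed.

(** A matrix commuting with [A] that kills [v] kills every [A ^+ k *m v], and these span. *)
Lemma cyclic_eq0 (B : 'M[F]_n.+1) : GRing.comm B A -> B *m v = 0 -> B = 0.
Proof.
move=> BA Bv; have B0 (w : 'cV[F]_n.+1) : B *m w = 0.
  have [u ->] := Av_span w; rewrite mulmx_sumr big1// => k _.
  rewrite -scalemxAr mulmxA -[B *m _]/(B * A ^+ k) (commrX k BA).
  by rewrite -[_ * B]/(_ *m B) -mulmxA Bv mulmx0 scaler0.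
by apply/row_matrixP => i; apply/rowP => j; move/colP/(_ i): (B0 (delta_mx j 0)); rewrite -colE !mxE.
Qed.

Lemma horner_mx_trinomial a b :
  horner_mx A ('X^(M.+1) - a *: 'X - b%:P) = A ^+ M.+1 - a *: A - b%:M.
Proof. by rewrite !rmorphB /= rmorphXn /= linearZ /= horner_mx_X horner_mx_C. Qed.

Lemma comm_trinomial a b : GRing.comm (A ^+ M.+1 - a *: A - b%:M) A.
Proof.
rewrite -horner_mx_trinomial -[X in GRing.comm _ X](horner_mx_X A).
by rewrite /GRing.comm -!rmorphM mulrC.
Qed.

Lemma cyclic_annihilated : A ^+ M.+1 = c *: A + d%:M.
Proof.
apply/eqP; rewrite -subr_eq0 opprD addrA; apply/eqP.
apply: cyclic_eq0; first exact: comm_trinomial.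
by rewrite !mulmxBl Av_top -scalemxAl mul_scalar_mx addrAC addrK subrr.
Qed.

(** Evaluating the difference of the two annihilating polynomials at [v] gives a relation between
    [A *m v] and [v], which are independent. *)
Lemma trinomial_unique a b : v != 0 -> (forall s, A *m v <> s *: v) ->
  horner_mx A ('X^(M.+1) - a *: 'X - b%:P) = 0 -> a = c /\ b = d.
Proof.
move=> v0 nAv; rewrite horner_mx_trinomial cyclic_annihilated.
move/(congr1 (mulmxr v)); rewrite /= mul0mx !mulmxBl mulmxDl -!scalemxAl !mul_scalar_mx => E.
have {}E : (c - a) *: (A *m v) = (b - d) *: v.
  by apply/eqP; rewrite -subr_eq0 -E; apply/eqP/colP => i; rewrite !mxE; ring.
have ac : a = c.
  apply/eqP; rewrite eq_sym -subr_eq0; apply/negPn/negP => ca.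
  apply: (nAv ((c - a)^-1 * (b - d))).
  by rewrite -scalerA -E scalerA mulVf// scale1r.
split=> //; move: E; rewrite ac subrr scale0r => /esym/eqP.
by rewrite scaler_eq0 (negbTE v0) orbF subr_eq0 => /eqP.
Qed.

Lemma cyclic_unitmx : d != 0 -> A \in unitmx.
Proof.
move=> d0; have E : A * (d^-1 *: (A ^+ M - c%:M)) = 1.
  rewrite -scalerAr mulrBr -exprS cyclic_annihilated.
  rewrite -[_ * c%:M]/(A *m c%:M) mul_mx_scalar [_ + d%:M]addrC addrK.
  by rewrite scale_scalar_mx mulVf.
by have [] := mulmx1_unit E.
Qed.

(** The minimal polynomial divides the characteristic one and both are monic, so it suffices that
    its degree is at least the dimension. *)
Lemma cyclic_nonderogatory : nonderogatory A.
Proof.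
apply/eqP; rewrite /nonderogatory -eqp_monic ?mxminpoly_monic ?char_poly_monic//.
rewrite -dvdp_size_eqp ?mxminpoly_dvd_char// size_char_poly size_mxminpoly eqSS.
have := dvdp_leq _ (mxminpoly_dvd_char A); rewrite monic_neq0 ?char_poly_monic// => /(_ isT).
rewrite size_char_poly size_mxminpoly ltnS eqn_leq => -> /=.
set d' := degree_mxminpoly A.
(* The rows are the first [d'] vectors of the orbit of [v]; if they span, [d'] is at least
   [n.+1]. *)
pose S : 'M[F]_(d', n.+1) := \matrix_(i < d', j < n.+1) (A ^+ i *m v) j 0.
suff : row_full S by move=> /eqP <-; exact: rank_leq_row.
rewrite -sub1mx; apply/row_subP => i; rewrite row1.
have [u E] := Av_span (delta_mx i 0).
pose q := \poly_(k < M.+1) u k.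
have qE : horner_mx A q *m v = delta_mx i 0.
  rewrite E /q poly_def rmorph_sum mulmx_suml; apply: eq_bigr => k _.
  by rewrite /= linearZ /= rmorphXn /= horner_mx_X -scalemxAl.
(* Reduction modulo the minimal polynomial expresses any vector through the first [d'] orbit
   vectors. *)
pose r := q %% mxminpoly A.
have rE : horner_mx A r = horner_mx A q.
  by rewrite [in RHS](divp_eq q (mxminpoly A)) rmorphD rmorphM /= mx_root_minpoly mulr0 add0r.
have rs : r = \poly_(k < d') r`_k.
  apply/polyP => k; rewrite coef_poly; case: ltnP => // dk.
  by rewrite nth_default// (leq_trans (size_mod_mxminpoly _ _)).
apply/submxP; exists (\row_k r`_k); apply/rowP => j.
have /colP/(_ j) jE := qE.
rewrite -rE rs poly_def rmorph_sum mulmx_suml summxE mxE eqxx andbT in jE.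
rewrite !mxE eqxx /= -jE; apply: eq_bigr => k _.
by rewrite /= linearZ /= rmorphXn /= horner_mx_X -scalemxAl !mxE.
Qed.
End CyclicVector.

(** * Local exponents and the exponent of an invertible cone-preserving matrix *)

Section Exponents.
Context {R : realType} {n M : nat}.
Local Notation V := 'cV[R]_n.+1.
Variables (K : set V) (x : 'I_M.+1 -> V) (A : 'M[R]_n.+1).
Hypotheses (clK : closed K) (cK : convex_cone K) (pK : pointed_cone K).
Hypotheses (xK : extreme_labelling K x) (Kfull : lspan K = fullv).
Hypotheses (AK : cone_nonneg K A) (A_unit : A \in unitmx).

Lemma cone_expr k y : K y -> K (A ^+ k *m y).
Proof. by elim: k y => [|k IH] y Ky; [rewrite expr0 mul1mx|rewrite mulmx_expr; exact/AK/IH]. Qed.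

Lemma interior_expr k y : K° y -> K° (A ^+ k *m y).
Proof.
move=> Ky; elim: k => [|k IH]; first by rewrite expr0 mul1mx.
by rewrite mulmx_expr; exact: (interior_mulmx clK cK pK xK Kfull AK A_unit IH).
Qed.

Lemma interior_leq j k y : (j <= k)%N -> K° (A ^+ j *m y) -> K° (A ^+ k *m y).
Proof.
by move=> jk /(interior_expr (k - j)); rewrite mulmxA -[_ *m A ^+ j]/(_ * _) -exprD subnK.
Qed.

(** The power is [(c A + d) ^+ M], whose binomial expansion has positive coefficients on all of [v],
    ..., [A ^+ M *m v]. *)
Lemma cyclic_interior (v : V) (c d : R) :
  (forall w : V, exists u : nat -> R, w = \sum_(k < M.+1) u k *: (A ^+ k *m v)) ->
  A ^+ M.+1 = c *: A + d%:M -> 0 < c -> 0 < d -> K v ->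
  K° (A ^+ (M.+1 * M) *m v).
Proof.
move=> vspan AE c0 d0 Kv; rewrite exprM AE addrC exprDn_comm; last first.
  by rewrite /GRing.comm -scalerAr -scalerAl -[_ * A]/(_ *m A) mul_scalar_mx -[A * _]/(A *m _) mul_mx_scalar.
rewrite mulmx_suml.
have -> : \sum_(i < M.+1) (d%:M ^+ (M - i) * (c *: A) ^+ i) *+ 'C(M, i) *m v =
   \sum_(i < M.+1) (d ^+ (M - i) * c ^+ i * 'C(M, i)%:R) *: (A ^+ i *m v).
  apply: eq_bigr => i _; rewrite -rmorphXn exprZn -scalerAr /= -scaler_nat.
  rewrite -[_%:M * _]/(_%:M *m _) mul_scalar_mx !scalerA -scalemxAl.
  by congr (_ *: _); ring.
apply: (@interior_combination _ _ _ cK _ (fun i : 'I_M.+1 => A ^+ i *m v)).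
- by move=> i; exact: cone_expr.
- by move=> i; rewrite !mulr_gt0 ?exprn_gt0// ltr0n bin_gt0 -ltnS.
apply/eqP; rewrite eqEsubv subvf /=; apply/subvP => w _.
have [u ->] := vspan w; apply: memv_suml => i _.
by rewrite memvZ// memv_span//; apply/mapP; exists i; rewrite ?mem_enum.
Qed.

Lemma primitive_powerP p : (0 < p)%N -> (forall i, K° (A ^+ p *m x i)) ->
  primitive_power K A p.
Proof.
move=> p0 Ap; split=> // y Ky y0.
have [c c0 yE] := labelling_generates clK cK pK xK Ky.
have [i ci] : exists i, 0 < c i.
  apply: contrapT => nc; move/eqP: y0; apply; rewrite yE big1// => i _.
  have : ~~ (0 < c i) by apply/negP => ci; apply: nc; exists i.
  by rewrite lt_neqAle c0 andbT negbK => /eqP <-; rewrite scale0r.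
rewrite yE mulmx_sumr (bigD1 i)//=; apply: (interiorD clK cK pK xK Kfull).
  by rewrite -scalemxAr; apply: (interiorZ clK cK pK xK Kfull).
apply: cone_sum => // j _; rewrite -scalemxAr; apply: coneZ => //.
exact: interior_subset (Ap j).
Qed.

(** Interior points stay interior under [A], so by time [g] all extreme vectors have entered the
    interior, [x i0] alone not before [g]. *)
Lemma exponent_attained g i0 : (0 < g)%N -> K° (A ^+ g *m x i0) ->
  (forall k, (k < g)%N -> ~ K° (A ^+ k *m x i0)) ->
  (forall i, i != i0 -> exists2 k, (k < g)%N & K° (A ^+ k *m x i)) ->
  [/\ cone_primitive K A, exponent K A = local_exponent K A (x i0)
    & exists! i, forall j, (local_exponent K A (x j) <= local_exponent K A (x i))%E].
Proof.
move=> g0 Kg gmin Ki.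
have pg : primitive_power K A g.
  apply: primitive_powerP => // i; have [->//|/Ki[k kg Kk]] := eqVneq i i0.
  exact: (interior_leq (ltnW kg) Kk).
have l0 : local_exponent K A (x i0) = g%:Z%:E.
  by apply/leastP; split=> // j Kj; rewrite leqNgt; apply/negP => /gmin.
have li i : i != i0 -> (local_exponent K A (x i) < local_exponent K A (x i0))%E.
  move=> /Ki[k kg Kk]; rewrite l0.
  have exk : exists k, `[< K° (A ^+ k *m x i) >] by exists k; apply/asboolP.
  have [l /asboolP Kl lmin] := ex_minnP exk.
  have -> : local_exponent K A (x i) = l%:Z%:E.
    by apply/leastP; split=> // j Kj; apply/lmin/asboolP.
  by rewrite lte_fin ltz_nat (leq_ltn_trans _ kg)//; apply/lmin/asboolP.
split.
- by split=> //; exists g.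
- rewrite l0; apply/leastP; split=> // p [p0 Kp]; rewrite leqNgt; apply/negP => /gmin; apply.
  by apply: Kp; [exact: labelling_cone xK i0|exact: labelling_neq0 xK i0].
- exists i0; split=> [j|j jmax]; first by have [->//|/li/ltW] := eqVneq j i0.
  by apply/eqP; rewrite eq_sym; apply/negPn/negP => /li; rewrite ltNge jmax.
Qed.
End Exponents.

(** * Orbits of the extreme vectors under the digraphs [F1] and [F2] *)

Section Digraphs.
Context {R : realType} {n M : nat}.
Local Notation V := 'cV[R]_n.+1.
Variables (K : set V) (x : 'I_M.+1 -> V) (A : 'M[R]_n.+1).
Hypotheses (clK : closed K) (cK : convex_cone K) (pK : pointed_cone K).
Hypotheses (xK : extreme_labelling K x) (Kfull : lspan K = fullv).
Hypotheses (AK : cone_nonneg K A) (M2 : (1 < M)%N).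

Let M1 : (0 < M)%N := ltnW M2.

Lemma powers_span (v : V) :
  (forall i, exists u : nat -> R, x i = \sum_(k < M.+1) u k *: (A ^+ k *m v)) ->
  forall w : V, exists u : nat -> R, w = \sum_(k < M.+1) u k *: (A ^+ k *m v).
Proof.
move=> xv w; pose X := [tuple A ^+ k *m v | k < M.+1].
have wX : w \in span X.
  have : w \in span [tuple x i | i < M.+1].
    by rewrite (labelling_span clK cK pK xK Kfull) memvf.
  apply/subvP/span_subvP => _ /mapP[i _ ->]; have [u ->] := xv i.
  apply: memv_suml => k _; rewrite memvZ// memv_span//.
  by apply/mapP; exists k; rewrite ?mem_enum.
exists (fun k => coord X (inord k) w); rewrite {1}(coord_span wX).
by apply: eq_bigr => k _; rewrite inord_val -tnth_nth tnth_mktuple.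
Qed.

Lemma labelling_not_interior i j (a : R) : 0 <= a -> j != i -> ~ K° (a *: x i).
Proof.
move=> a0 ji /(interior_line (x j))[t t0 Kt].
by move: ji; rewrite (labelling_arc_multiple cK pK xK t0 a0 Kt) eqxx.
Qed.

Lemma arc_not_interior (e : rel 'I_M.+1) i j : digraph_given_by K A x e ->
  ~~ e i j -> ~ K° (A *m x i).
Proof.
move=> Ae /negP eij /(interior_line (x j))[t t0 Kt]; apply: eij.
by apply/Ae/(cone_arcP cK xK AK); exists t.
Qed.

Local Notation X k := (x (inord k)).

Let inordE k : (k <= M)%N -> (inord k : 'I_M.+1) = k :> nat.
Proof. by move=> kM; rewrite inordK. Qed.

Let inord_eq (i : 'I_M.+1) k : (k <= M)%N -> (i == inord k) = (i == k :> nat).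
Proof. by move=> kM; rewrite -val_eqE /= inordK. Qed.

Let expr_pred (w : V) : A ^+ M *m w = A *m (A ^+ M.-1 *m w).
Proof. by rewrite -mulmx_expr prednK. Qed.

Section F1.
Hypothesis AF : digraph_given_by K A x (@F1 M.+1).

Lemma F1_step k : (k < M)%N -> exists2 s : R, 0 < s & A *m X k = s *: X k.+1.
Proof.
move=> kM; apply: (digraph_single clK cK pK xK AK AF) => j.
by rewrite /F1 inordE ?(ltnW kM)// eqSS (ltn_eqF kM) /= orbF inord_eq.
Qed.

Lemma F1_top : exists a b : R, [/\ 0 < a, 0 < b & A *m X M = a *: X 0 + b *: X 1].
Proof.
apply: (digraph_double clK cK pK xK AK AF) => [|j].
  by rewrite -val_eqE /= !inordK.
by rewrite /F1 inordE// eqxx /= !inord_eq// [_ == M.+1 :> nat]ltn_eqF.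
Qed.

Lemma F1_power k : (k <= M)%N -> exists2 s : R, 0 < s & A ^+ k *m X 0 = s *: X k.
Proof.
elim: k => [|k IH] kM; first by exists 1; rewrite // expr0 mul1mx scale1r.
have [s s0 E] := IH (ltnW kM); have [t t0 E'] := F1_step kM.
exists (s * t); first by rewrite mulr_gt0.
by rewrite mulmx_expr E -scalemxAr E' scalerA.
Qed.

Lemma F1_power_top : exists a b : R, [/\ 0 < a, 0 < b
  & A ^+ M.+1 *m X 0 = b *: (A *m X 0) + a *: X 0].
Proof.
have [a [b [a0 b0 E]]] := F1_top; have [s s0 E'] := F1_power (leqnn M).
have [t t0 Et] := F1_step M1.
exists (s * a), (s * b / t); split; rewrite ?divr_gt0 ?mulr_gt0//.
rewrite mulmx_expr E' -scalemxAr E Et scalerDr !scalerA addrC.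
by rewrite divfK ?gt_eqF.
Qed.

Lemma F1_span (w : V) : exists u : nat -> R, w = \sum_(k < M.+1) u k *: (A ^+ k *m X 0).
Proof.
move: w; apply: powers_span => i; have [s s0 E] := F1_power (ltn_ord i : (i <= M)%N).
exists (fun k : nat => (k == i :> nat)%:R / s); rewrite (bigD1 i)//= big1 => [|k ki].
  by rewrite eqxx E addr0 scalerA mul1r mulVf ?gt_eqF// scale1r inord_val.
by move: ki; rewrite -val_eqE /= => /negbTE ->; rewrite mul0r scale0r.
Qed.

Lemma F1_not_scalar s : A *m X 0 <> s *: X 0.
Proof.
have [t t0 ->] := F1_step M1; move=> /(congr1 (fun z => t^-1 *: z)).
rewrite !scalerA mulVf ?gt_eqF// scale1r => /(labelling_distinct xK) /(congr1 val) /=.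
by rewrite !inordK.
Qed.

(** Up to time [M] the orbit of [x_0] stays on extreme rays, so [g] exceeds [M]. Each [x_i] is a
    positive multiple of [A ^+ i *m x_0], so it needs [i] steps fewer. *)
Lemma F1_attained g : K° (A ^+ g *m X 0) ->
  (forall k, K° (A ^+ k *m X 0) -> (g <= k)%N) ->
  (0 < g)%N /\ forall i, i != inord 0 -> exists2 k, (k < g)%N & K° (A ^+ k *m x i).
Proof.
move=> Kg gmin.
have Mg : (M < g)%N.
  rewrite ltnNge; apply/negP => gM; have [s s0 E] := F1_power gM.
  (* The index [g == 0], read as a number, is a vertex different from [g]. *)
  rewrite E in Kg; apply: (@labelling_not_interior (inord g) (inord (g == 0)%N) s) Kg.
    exact: ltW.
  by rewrite -val_eqE /= !inordK ?ltnS//; [case: (g)|case: (g == 0)%N].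
split=> [|i i0]; first exact: leq_ltn_trans Mg.
have iM : (i <= M)%N by rewrite -ltnS.
have [s s0 E] := F1_power iM; rewrite inord_val in E.
exists (g - i)%N.
  by rewrite ltn_subrL lt0n (leq_ltn_trans (leq0n _) Mg) andbT; move: i0; rewrite -val_eqE /= inordK.
apply: (interiorZr clK cK pK xK Kfull s0); rewrite scalemxAr -E mulmxA.
by rewrite -[_ *m A ^+ i]/(_ * _) -exprD subnK// (leq_trans iM) // ltnW.
Qed.

End F1.

Section F2.
Hypothesis AF : digraph_given_by K A x (@F2 M.+1).

Lemma F2_step k : (0 < k)%N -> (k < M)%N ->
  exists2 s : R, 0 < s & A *m X k = s *: X k.+1.
Proof.
move=> k0 kM; apply: (digraph_single clK cK pK xK AK AF) => j.
by rewrite /F2 /F1 inordE ?(ltnW kM)// eqSS (ltn_eqF kM) (gtn_eqF k0) /= !orbF inord_eq.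
Qed.

Lemma F2_top : exists a b : R, [/\ 0 < a, 0 < b & A *m X M = a *: X 0 + b *: X 1].
Proof.
apply: (digraph_double clK cK pK xK AK AF) => [|j].
  by rewrite -val_eqE /= !inordK.
rewrite /F2 /F1 inordE// eqxx (gtn_eqF M1) /= orbF !inord_eq//.
by rewrite [_ == M.+1 :> nat]ltn_eqF.
Qed.

Lemma F2_bottom : exists a b : R, [/\ 0 < a, 0 < b & A *m X 0 = a *: X 1 + b *: X 2].
Proof.
apply: (digraph_double clK cK pK xK AK AF) => [|j].
  by rewrite -val_eqE /= !inordK.
by rewrite /F2 /F1 inordE// (eqSS 0) (ltn_eqF M1) /= orbF !inord_eq.
Qed.

Lemma F2_power k : (k < M)%N -> exists2 s : R, 0 < s & A ^+ k *m X 1 = s *: X k.+1.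
Proof.
elim: k => [|k IH] kM; first by exists 1; rewrite // expr0 mul1mx scale1r.
have [s s0 E] := IH (ltnW kM); have [t t0 E'] := F2_step (isT : 0 < k.+1)%N kM.
exists (s * t); first by rewrite mulr_gt0.
by rewrite mulmx_expr E -scalemxAr E' scalerA.
Qed.

(** The scaled vector [s *: x_0] takes the place of [x_0], so that it appears with coefficient one
    in [A ^+ M *m x_1]. *)
Lemma F2_power_top : exists s e a b : R, [/\ 0 < s, 0 < e, 0 < a, 0 < b &
  A ^+ M *m X 1 = s *: X 0 + e *: X 1 /\
  A *m (s *: X 0) = a *: X 1 + b *: (A *m X 1)].
Proof.
have [a [b [a0 b0 E]]] := F2_top.
have [s s0 E'] : exists2 s : R, 0 < s & A ^+ M.-1 *m X 1 = s *: X M.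
  by have := @F2_power M.-1; rewrite prednK//; apply.
have [c [d [c0 d0 E0]]] := F2_bottom; have [t t0 Et] := F2_step (isT : 0 < 1)%N M2.
exists (s * a), (s * b), (s * a * c), (s * a * d / t).
split; rewrite ?divr_gt0 ?mulr_gt0//; split.
  by rewrite expr_pred E' -scalemxAr E scalerDr !scalerA.
by rewrite -scalemxAr E0 Et scalerDr !scalerA divfK ?gt_eqF.
Qed.

Lemma F2_annihilated s e a b : A ^+ M *m X 1 = s *: X 0 + e *: X 1 ->
  A *m (s *: X 0) = a *: X 1 + b *: (A *m X 1) ->
  A ^+ M.+1 *m X 1 = (b + e) *: (A *m X 1) + a *: X 1.
Proof.
move=> E E'; rewrite mulmx_expr E mulmxDr E' -scalemxAr.
by apply/colP => i; rewrite !mxE; ring.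
Qed.

Lemma F2_span (w : V) : exists u : nat -> R, w = \sum_(k < M.+1) u k *: (A ^+ k *m X 1).
Proof.
move: w; apply: powers_span => i.
have [i0|i0] := posnP i.
  have [s [e [_ [_ [s0 _ _ _ [E _]]]]]] := F2_power_top.
  (* Solves [A ^+ M *m x_1 = s *: x_0 + e *: x_1] for [x_0]. *)
  exists (fun k => ((k == M)%:R - (k == 0)%:R * e) / s).
  have split_sum (G : nat -> V) :
      \sum_(k < M.+1) G k = G 0%N + \sum_(k < M.-1) G k.+1 + G M.
    by case: (M) M1 => // k _; rewrite big_ord_recl big_ord_recr addrA.
  rewrite [RHS](split_sum (fun k => (((k == M)%:R - (k == 0)%:R * e) / s) *: (A ^+ k *m X 1))) /=.
  rewrite big1 => [|k _]; last first.
    have kM : (k.+1 < M)%N by have := ltn_ord k; rewrite -ltnS prednK.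
    by rewrite (ltn_eqF kM) !mul0r subr0 mul0r scale0r.
  rewrite E (ltn_eqF M1) (gtn_eqF M1) !eqxx expr0 mul1mx mul1r mul0r addr0 sub0r subr0.
  have -> : i = inord 0 by apply/val_inj; rewrite /= inordK.
  by rewrite mulr1n; apply/colP => j; rewrite !mxE; field; rewrite gt_eqF.
have iM : (i.-1 < M)%N by rewrite prednK// -ltnS.
have [s s0 E] := F2_power iM; rewrite prednK// inord_val in E.
have iM' : (i.-1 < M.+1)%N by exact: ltnW.
exists (fun k => (k == i.-1)%:R / s); rewrite (bigD1 (Ordinal iM'))//= big1 => [|k ki].
  by rewrite eqxx E addr0 scalerA mul1r mulVf ?gt_eqF// scale1r.
by move: ki; rewrite -val_eqE /= => /negbTE ->; rewrite mul0r scale0r.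
Qed.

Lemma F2_not_scalar s : A *m X 1 <> s *: X 1.
Proof.
have [t t0 ->] := F2_step (isT : 0 < 1)%N M2; move=> /(congr1 (fun z => t^-1 *: z)).
rewrite !scalerA mulVf ?gt_eqF// scale1r => /(labelling_distinct xK) /(congr1 val) /=.
by rewrite !inordK.
Qed.

Lemma F2_attained g : K° (A ^+ g *m X 1) ->
  (forall k, K° (A ^+ k *m X 1) -> (g <= k)%N) ->
  (0 < g)%N /\ forall i, i != inord 1 -> exists2 k, (k < g)%N & K° (A ^+ k *m x i).
Proof.
move=> Kg gmin.
(* Before time [M] the orbit of [x_1] is on extreme rays. At time [M] it is a multiple of
   [A *m x_M], and there is no arc from [x_M] to vertex 2. *)
have Mg : (M < g)%N.
  rewrite ltnNge leq_eqVlt; apply/negP => /predU1P[gM|gM].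
    have [s s0 E'] : exists2 s : R, 0 < s & A ^+ M.-1 *m X 1 = s *: X M.
      by have := @F2_power M.-1; rewrite prednK//; apply.
    move: Kg; rewrite gM expr_pred E' -scalemxAr.
    move=> /(interiorZr clK cK pK xK Kfull s0).
    apply: (@arc_not_interior _ _ (inord 2) AF).
    by rewrite /F2 /F1 !inordK// eqxx (gtn_eqF M1) /= !orbF ltn_eqF.
  have [s s0 E] := F2_power gM.
  rewrite E in Kg; apply: (@labelling_not_interior (inord g.+1) (inord 0) s) Kg.
    exact: ltW.
  by rewrite -val_eqE /= !inordK ?ltnS.
split=> [|i i1]; first exact: leq_ltn_trans Mg.
have [i0|i0] := posnP i.
  have [s [e [a [b [s0 e0 a0 b0 [E E']]]]]] := F2_power_top.
  exists (g - M)%N; first by rewrite ltn_subrL M1 (leq_ltn_trans _ Mg).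
  have -> : i = inord 0 by apply/val_inj; rewrite /= inordK.
  apply: (interiorZr clK cK pK xK Kfull s0).
  have gM : (g - M = (g - M.+1).+1)%N by rewrite subnS prednK// subn_gt0.
  rewrite scalemxAr gM exprSr -[_ * A]/(_ *m A) -mulmxA E'.
  move: Kg; rewrite -(subnK Mg) exprD -[_ * _ ^+ M.+1]/(_ *m _) -mulmxA.
  rewrite (F2_annihilated E E') addnK.
  (* Scaling [(b + e) A x_1 + a x_1] by [b / (b + e)] gives the right multiple of [A x_1]; the
     missing multiple of [x_1] is [a * e / (b + e)], which is nonnegative. Hence [x_0] enters the
     interior by time [g - M]. *)
  have be : 0 < b / (b + e) by rewrite divr_gt0 ?addr_gt0.
  move=> /(interiorZ clK cK pK xK Kfull be) KI.
  have Kv : K (A ^+ (g - M.+1) *m X 1) by apply: (cone_expr AK); exact: labelling_cone xK _.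
  have ae : 0 <= a * e / (b + e) by rewrite divr_ge0 ?mulr_ge0 ?addr_ge0 ?ltW.
  have := interiorD clK cK pK xK Kfull KI (coneZ cK ae Kv).
  congr (K° _); rewrite !mulmxDr -!scalemxAr; apply/colP => j; rewrite !mxE.
  by field; rewrite gt_eqF ?addr_gt0.
have iM : (i.-1 < M)%N by rewrite prednK// -ltnS.
have [s s0 E] := F2_power iM; rewrite prednK// inord_val in E.
exists (g - i.-1)%N.
  rewrite ltn_subrL (leq_ltn_trans (leq0n _) Mg) andbT -subn1 subn_gt0.
  by rewrite ltn_neqAle i0 andbT eq_sym; move: i1; rewrite -val_eqE /= inordK.
apply: (interiorZr clK cK pK xK Kfull s0); rewrite scalemxAr -E mulmxA.
by rewrite -[_ *m A ^+ i.-1]/(_ * _) -exprD subnK// (leq_trans (ltnW iM)) // ltnW.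
Qed.
End F2.

Definition primitive_conclusion (i0 : 'I_M.+1) :=
  [/\ cone_primitive K A, A \in unitmx, nonderogatory A
    & exists! p : {poly R},
        (exists c d : R, [/\ 0 < c, 0 < d & p = 'X^(M.+1) - c *: 'X - d%:P]) /\
        horner_mx A p = 0] /\
  (exponent K A = local_exponent K A (x i0) /\
   exists! i, forall j, (local_exponent K A (x j) <= local_exponent K A (x i))%E).

Lemma cyclic_conclusion (i0 : 'I_M.+1) (c d : R) :
  (forall w : V, exists u : nat -> R, w = \sum_(k < M.+1) u k *: (A ^+ k *m x i0)) ->
  A ^+ M.+1 *m x i0 = c *: (A *m x i0) + d *: x i0 -> 0 < c -> 0 < d ->
  (forall s, A *m x i0 <> s *: x i0) ->
  (forall g, K° (A ^+ g *m x i0) ->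
    (forall k, K° (A ^+ k *m x i0) -> (g <= k)%N) ->
    (0 < g)%N /\ forall i, i != i0 -> exists2 k, (k < g)%N & K° (A ^+ k *m x i)) ->
  primitive_conclusion i0.
Proof.
move=> vspan vtop c0 d0 nscalar attained.
have AE := cyclic_annihilated vspan vtop.
have Au : A \in unitmx by apply: (cyclic_unitmx vspan vtop); rewrite gt_eqF.
have Ki := cyclic_interior cK AK vspan AE c0 d0 (labelling_cone xK i0).
have exg : exists k, `[< K° (A ^+ k *m x i0) >] by eexists; apply/asboolP; exact: Ki.
have [g /asboolP Kg gmin] := ex_minnP exg.
have {}gmin k : K° (A ^+ k *m x i0) -> (g <= k)%N by move=> Kk; apply/gmin/asboolP.
have [g0 gi] := attained g Kg gmin.
have gmin' k : (k < g)%N -> ~ K° (A ^+ k *m x i0) by move=> kg /gmin; rewrite leqNgt kg.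
have [prim expo uniq] := exponent_attained clK cK pK xK Kfull AK Au g0 Kg gmin' gi.
split=> //; split=> //; first exact: (cyclic_nonderogatory vspan).
exists ('X^(M.+1) - c *: 'X - d%:P); split.
  split; first by exists c, d.
  by rewrite horner_mx_trinomial AE addrAC addrK subrr.
move=> _ [[a [b [a0 b0 ->]]]] /(trinomial_unique vspan vtop (labelling_neq0 xK i0) nscalar).
by case=> -> ->.
Qed.

Lemma F1_conclusion : digraph_given_by K A x (@F1 M.+1) -> primitive_conclusion (inord 0).
Proof.
move=> AF; have [a [b [a0 b0 E]]] := F1_power_top AF.
exact: cyclic_conclusion (F1_span AF) E b0 a0 (F1_not_scalar AF) (F1_attained AF).
Qed.

Lemma F2_conclusion : digraph_given_by K A x (@F2 M.+1) -> primitive_conclusion (inord 1).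
Proof.
move=> AF; have [s [e [a [b [s0 e0 a0 b0 [E E0]]]]]] := F2_power_top AF.
exact: cyclic_conclusion (F2_span AF) (F2_annihilated E E0) (addr_gt0 b0 e0) a0
  (F2_not_scalar AF) (F2_attained AF).
Qed.

End Digraphs.

(** * Decompositions *)

Section Decompositions.
Context {R : realType} {n : nat}.
Local Notation V := 'cV[R]_n.
Implicit Types (K : set V).

Lemma linear_mulmx (f : {linear V -> V}) : exists P : 'M[R]_n, forall y, f y = P *m y.
Proof.
exists (\matrix_(i, j) f (delta_mx j 0) i 0) => y; apply/colP => i.
rewrite {1}[y]matrix_sum_delta linear_sum summxE mxE; apply: eq_bigr => j _.
by rewrite big_ord1 linearZ !mxE mulrC.
Qed.

(** Projecting onto [lspan K1] along [lspan K2] fixes or kills each extreme vector, since such a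
    vector lies in one of the summands. Neither alternative can hold for all of them, as both
    summands are nonzero. *)
Lemma decomposable_projection K m (x : 'I_m -> V) : convex_cone K ->
  (forall i, extreme_vector K (x i)) ->
  (forall y, K y -> exists c : 'I_m -> R, y = \sum_i c i *: x i) ->
  decomposable K ->
  exists (P : 'M[R]_n) (I : pred 'I_m), [/\ forall i, P *m x i = (I i)%:R *: x i,
    exists i, I i & exists i, ~~ I i].
Proof.
move=> cK ex gen [K1 [K2 [[c1 c2 KE cap] K1n K2n]]].
have K1K y : K1 y -> K y by rewrite KE => K1y; exists y => //; exists 0; [exact: cone0|rewrite addr0].
have K2K y : K2 y -> K y by rewrite KE => K2y; exists 0; [exact: cone0|exists y; rewrite ?add0r].
pose f := daddv_pi (lspan K1) (lspan K2).
have f1 y : K1 y -> f y = y by move=> /sub_lspan; exact: daddv_pi_id.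
have f2 y : K2 y -> f y = 0.
  move=> K2y; have y2 : y \in lspan K2 := sub_lspan K2y.
  have := daddv_pi_add cap (subvP (addvSr (lspan K1) (lspan K2)) _ y2).
  by rewrite (daddv_pi_id _ y2) 1?capvC// => /(canRL (addrK _)); rewrite subrr.
have [P fP] : exists P : 'M[R]_n, forall y, f y = P *m y := linear_mulmx f.
pose I i := `[< K1 (x i) >].
have PI i : P *m x i = (I i)%:R *: x i.
  rewrite -fP /I; case: asboolP => [/f1->|nK1]; rewrite ?scale1r// scale0r; apply: f2.
  have [Kx x0 _] := ex i; move: (Kx); rewrite KE => -[y K1y [z K2z xE]].
  have Kxy : K (x i - y) by rewrite -xE addrC addKr; exact: K2K.
  (* The [K1]-component is a multiple of [x i]: if zero, [x i] lies in [K2]; if positive, in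
     [K1]. *)
  have [a a0 yE] := extreme_summand cK (ex i) (K1K _ K1y) Kxy.
  move: a0; rewrite le_eqVlt => /predU1P[a0|a0].
    by rewrite -xE yE -a0 scale0r add0r.
  by case: nK1; apply: (coneZr c1 a0); rewrite -yE.
exists P, I; split=> //; apply: contrapT => nI.
  apply: K1n; apply/seteqP; split=> [y K1y|_ ->]; last exact: cone0.
  have [c yE] := gen _ (K1K _ K1y); rewrite /= -(f1 _ K1y) fP yE mulmx_sumr big1// => i _.
  rewrite -scalemxAr PI; case Ii: (I i); last by rewrite scale0r scaler0.
  by case: nI; exists i.
apply: K2n; apply/seteqP; split=> [y K2y|_ ->]; last exact: cone0.
have [c yE] := gen _ (K2K _ K2y); rewrite /= -(f2 _ K2y) fP yE mulmx_sumr.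
apply: eq_bigr => i _; rewrite -scalemxAr PI; case Ii: (I i); rewrite ?scale1r//.
by case: nI; exists i; rewrite Ii.
Qed.

Lemma labelling_polyhedral K m (x : 'I_m -> V) : closed K -> convex_cone K ->
  pointed_cone K -> extreme_labelling K x -> polyhedral_cone m (cone_dim K) K.
Proof.
move=> clK cK pK xK; split=> //.
  split=> //; exists (\sum_i 1 *: x i); split.
    by apply: (cone_comb cK xK) => i; exact: ler01.
  pose X := [tuple x i | i < m].
  have KX (i : 'I_m) : K X`_i by rewrite -tnth_nth tnth_mktuple; exact: labelling_cone xK i.
  have := relint_combination cK KX (fun=> ltr01).
  under eq_bigr do rewrite -tnth_nth tnth_mktuple.
  apply: filterS => y yX yK; apply: yX; move: yK; apply/subvP/lspan_min => z Kz /=.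
  have [c _ ->] := labelling_generates clK cK pK xK Kz; apply: memv_suml => i _.
  by rewrite memvZ// memv_span//; apply/mapP; exists i; rewrite ?mem_enum.
have -> : extreme_rays K = [set Phi K (x i) | i in [set: 'I_m]].
  apply/seteqP; split=> [_ [y ey <-]|_ [i _ <-]]; last by exists (x i) => //; exact: labelling_extreme xK i.
  by have [_ /(_ _ ey)[i ->]] := xK; exists i.
apply: (@card_eq_trans _ _ _ _ [set: 'I_m]); last first.
  by rewrite card_eq_sym card_II.
apply: inj_card_eq => i j _ _ Pij.
have [Kx x0 Px] := labelling_extreme xK j.
have := Phi_id cK (labelling_cone xK i); rewrite Pij Px => -[a _ E].
by apply: (labelling_distinct xK); symmetry; exact: E.
Qed.

End Decompositions.

(** * Splitting off the ray of an isolated extreme vector *)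

Section RayComplement.
Context {R : realType} {n m : nat}.
Local Notation V := 'cV[R]_n.
Variables (K : set V) (x : 'I_m.+1 -> V) (i0 : 'I_m.+1) (phi : {linear V -> R^o}).
Hypotheses (clK : closed K) (cK : convex_cone K) (pK : pointed_cone K).
Hypothesis xK : extreme_labelling K x.
Hypotheses (phi_i0 : phi (x i0) = 1) (phi_neq : forall i, i != i0 -> phi (x i) = 0).
Let K' := K `&` [set y | phi y = 0].

Lemma phi_comb (c : 'I_m.+1 -> R) : phi (\sum_i c i *: x i) = c i0.
Proof.
rewrite linear_sum (bigD1 i0)//= big1 => [|i /phi_neq E]; last by rewrite linearZ /= E scaler0.
by rewrite linearZ /= phi_i0 addr0 [LHS]mulr1.
Qed.

Lemma phi_ge0 y : K y -> 0 <= phi y.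
Proof. by move=> /(labelling_generates clK cK pK xK)[c c0 ->]; rewrite phi_comb. Qed.

Lemma complement_closed : closed K'.
Proof.
apply: closedI => //; apply: (@closed_comp _ _ phi [set 0]) => [y _|].
  exact: lin_continuous.
exact: closed_eq.
Qed.

Lemma complement_cone : convex_cone K'.
Proof.
split=> [|y z [Ky /= y0] [Kz /= z0]|a y a0 [Ky /= y0]].
- by split; [exact: cone0|exact: linear0].
- by split; [exact: coneD|rewrite /= linearD y0 z0 addr0].
- by split; [exact: coneZ|rewrite /= linearZ /= y0 scaler0].
Qed.

Lemma complement_pointed : pointed_cone K'.
Proof.
apply/seteqP; split=> [y [[Ky _] [KNy _]]|_ ->]; first exact: pointed0 Ky KNy.
by split; rewrite /= ?oppr0; exact: cone0 complement_cone.
Qed.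

(** As [phi] is nonnegative on [K], anything dominated by a zero of [phi] is again a zero, so the
    smallest faces agree. *)
Lemma complement_Phi y : K' y -> Phi K' y = Phi K y.
Proof.
move=> K'y; have [Ky /= y0] := K'y.
apply/seteqP; split=> z /PhiP.
  by move=> /(_ complement_cone K'y)[[Kz _] [t t0 [Kt _]]]; apply/PhiP => //; split=> //; exists t.
move=> /(_ cK Ky)[Kz [t t0 Kt]]; apply/PhiP => //; first exact: complement_cone.
have z0 : phi z = 0.
  apply/eqP; rewrite eq_le phi_ge0// andbT.
  have := phi_ge0 Kt; rewrite linearB y0 linearZ /= sub0r oppr_ge0.
  by rewrite -[_ *: _]/(t * _) pmulr_rle0.
by split=> //; exists t => //; split=> //=; rewrite linearB linearZ /= y0 z0 scaler0 subrr.
Qed.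

Lemma complement_extreme y : extreme_vector K' y <-> extreme_vector K y /\ phi y = 0.
Proof.
split=> [[K'y y0 Py]|[[Ky y0 Py] py]].
  by have [Ky py] := K'y; split=> //; split=> //; rewrite -complement_Phi.
by split=> //; rewrite complement_Phi.
Qed.

Lemma complement_labelling : extreme_labelling K' (fun k => x (lift i0 k)).
Proof.
have ext k : extreme_vector K' (x (lift i0 k)).
  apply/complement_extreme; split; first exact: labelling_extreme xK _.
  by apply: phi_neq; rewrite eq_sym neq_lift.
split; first split=> // i j ij [a E].
  by apply: ij; apply: (@lift_inj _ i0); exact: (labelling_distinct xK E).
move=> y ey; have [eyK py] := (complement_extreme y).1 ey.
have [i [a [a0 yE]]] := labelling_extreme_multiple cK xK eyK.
have [j|ji] := unliftP i0 i.
  move=> ij; exists j; rewrite -ij yE PhiZ//; first exact: complement_cone.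
  by rewrite ij; have [] := ext j.
by move: py; rewrite yE linearZ /= ji phi_i0 => /eqP; rewrite mulf_eq0 gt_eqF//= oner_eq0.
Qed.

Lemma complement_direct_sum : direct_sum K (ray (x i0)) K'.
Proof.
have Kx := labelling_cone xK i0.
split.
- split=> [|_ _ [a /= a0 <-] [b /= b0 <-]|a _ a0 [b /= b0 <-]].
  + by exists 0; rewrite /= ?scale0r.
  + by exists (a + b); rewrite /= ?scalerDl// addr_ge0.
  + by exists (a * b); rewrite /= ?scalerA// mulr_ge0.
- exact: complement_cone.
- apply/seteqP; split=> [y Ky|_ [_ [a /= a0 <-] [z [Kz _] <-]]]; last first.
    by apply: coneD => //; exact: coneZ.
  have [c c0 yE] := labelling_generates clK cK pK xK Ky.
  exists (c i0 *: x i0); first by exists (c i0); rewrite /=.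
  exists (y - c i0 *: x i0); last by rewrite addrC subrK.
  split; last by rewrite /= linearB linearZ /= phi_i0 yE phi_comb [_ *: _]mulr1 subrr.
  rewrite yE (bigD1 i0)//= addrAC subrr add0r; apply: cone_sum => // i _.
  by apply: coneZ => //; exact: labelling_cone xK i.
have rayL : (lspan (ray (x i0)) <= <[x i0]>)%VS.
  by apply: lspan_min => _ [a _ <-] /=; rewrite memvZ// memv_line.
have K'L : (lspan K' <= lker (linfun phi))%VS.
  by apply: lspan_min => y [_ /= y0] /=; rewrite memv_ker lfunE /= y0.
apply/eqP; rewrite -subv0; apply/subvP => y; rewrite memv_cap => /andP[].
move=> /(subvP rayL) /vlineP[a ->] /(subvP K'L); rewrite memv_ker lfunE /= linearZ /= phi_i0.
by rewrite [_ *: _]mulr1 => /eqP ->; rewrite scale0r mem0v.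
Qed.

End RayComplement.

Lemma linear_relation_exists (F : fieldType) (N M : nat) (y : nat -> 'cV[F]_N) :
  (N < M.+1)%N ->
  exists u, linear_relation M y u /\ exists2 k, (k <= M)%N & u k != 0.
Proof.
move=> NM; pose S : 'M[F]_(M.+1, N) := \matrix_(i, j) y i j 0.
have kS : kermx S != 0.
  by rewrite kermx_eq0 -row_leq_rank -ltnNge (leq_ltn_trans (rank_leq_col S)).
have [r r0 rS] : exists2 r : 'rV[F]_M.+1, r != 0 & r *m S = 0.
  exists (nz_row (kermx S)); first by rewrite nz_row_eq0.
  by apply/sub_kermxP; exact: nz_row_sub.
exists (fun k => r 0 (inord k)); split.
  apply/colP => j; rewrite summxE; move/rowP/(_ j): rS; rewrite mxE [RHS]mxE => R0.
  rewrite [RHS]mxE -[RHS]R0.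
apply: eq_bigr => k _.
  by rewrite !mxE inord_val.
have [j rj] : exists j, r 0 j != 0.
  apply: contrapT => nz; move/eqP: r0; apply; apply/rowP => j; rewrite [RHS]mxE.
  by apply/eqP/negPn/negP => nzj; apply: nz; exists j.
by exists j; [rewrite -ltnS|rewrite inord_val].
Qed.

Lemma proportional_separator (F : fieldType) (N M : nat) (x : 'I_M.+1 -> 'cV[F]_N)
    (y : nat -> 'cV[F]_N) (P : 'M[F]_N) (I : pred 'I_M.+1) :
  (forall i, P *m x i = (I i)%:R *: x i) ->
  (forall k, (k <= M)%N -> exists s, y k = s *: x (inord k)) ->
  separator M y (fun k => I (inord k)).
Proof.
by move=> PI yx; exists P => k /yx[s ->]; rewrite -scalemxAr PI !scalerA mulrC.
Qed.

Section FunctionalOfRow.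
Context {R : realType} {n : nat} (r : 'rV[R]_n).

Definition row_functional (y : 'cV[R]_n) : R^o := (r *m y) 0 0.

Lemma row_functional_is_linear : linear row_functional.
Proof. by move=> a y z; rewrite /row_functional mulmxDr -scalemxAr !mxE. Qed.

HB.instance Definition _ := GRing.isLinear.Build R 'cV[R]_n R^o _
  row_functional row_functional_is_linear.
End FunctionalOfRow.

(** The functional is a row of [B] not vanishing at [x i0], normalised there. *)
Lemma isolated_functional (R : realType) (n m : nat) (x : 'I_m -> 'cV[R]_n)
    (B : 'M[R]_n) (i0 : 'I_m) : B *m x i0 != 0 ->
  (forall i, i != i0 -> B *m x i = 0) ->
  exists phi : {linear 'cV[R]_n -> R^o}, phi (x i0) = 1 /\ forall i, i != i0 -> phi (x i) = 0.
Proof.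
move=> Bx Bz; have [j Bj] : exists j, (B *m x i0) j 0 != 0.
  apply: contrapT => nz; move/eqP: Bx; apply; apply/colP => j; rewrite [RHS]mxE.
  by apply/eqP/negPn/negP => nzj; apply: nz; exists j.
pose r := ((B *m x i0) j 0)^-1 *: row j B.
have rE y : (r *m y) 0 0 = ((B *m x i0) j 0)^-1 * (B *m y) j 0.
  by rewrite -scalemxAl -row_mul !mxE.
exists (row_functional r); split=> [|i /Bz Bi]; rewrite /= /row_functional rE.
  by rewrite mulVf.
by rewrite Bi [X in _ * X]mxE mulr0.
Qed.

(** * Non-simplicial cones with digraph [F1] *)

Section Indecomposability.
Context {R : realType} {n M : nat}.
Local Notation V := 'cV[R]_n.+1.
Variables (K : set V) (x : 'I_M.+1 -> V) (A : 'M[R]_n.+1).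
Hypotheses (clK : closed K) (cK : convex_cone K) (pK : pointed_cone K).
Hypotheses (xK : extreme_labelling K x) (AK : cone_nonneg K A).
Hypotheses (M2 : (1 < M)%N) (nM : (n.+1 < M.+1)%N) (A_unit : A \in unitmx).

Lemma labelling_projection : decomposable K ->
  exists (P : 'M[R]_n.+1) (I : pred 'I_M.+1), [/\ forall i, P *m x i = (I i)%:R *: x i,
    exists i, I i & exists i, ~~ I i].
Proof.
apply: decomposable_projection => // [i|y /(labelling_generates clK cK pK xK)[c _ ->]].
  exact: labelling_extreme xK i.
by exists c.
Qed.

Lemma nonconstant (I : pred 'I_M.+1) : (exists i, I i) -> (exists i, ~~ I i) ->
  exists2 k, (k <= M)%N & I (inord k) != I (inord 0).
Proof.
move=> [i Ii] [j Ij]; case I0: (I (inord 0)).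
  by exists j; rewrite ?inord_val ?(negbTE Ij) // -ltnS.
by exists i; rewrite ?inord_val ?Ii // -ltnS.
Qed.

Lemma F1_indecomposable : digraph_given_by K A x (@F1 M.+1) -> indecomposable K.
Proof.
move=> AF /labelling_projection[P [I [PI It If]]].
(* The orbit rescales the [x i] so that every step except the last has coefficient one. *)
pose v := x (inord 0); pose y k := A ^+ k *m v.
have yx k : (k <= M)%N -> exists2 s : R, 0 < s & y k = s *: x (inord k).
  exact: (F1_power clK cK pK xK AK AF).
have [k kM] := nonconstant It If; apply/negP; rewrite negbK; apply/eqP.
have [u [ru u0]] := linear_relation_exists y nM.
have [a [b [a0 b0 E]]] := F1_power_top clK cK pK xK AK M2 AF.
apply: (@wielandt_connected _ _ _ y A a b M2 A_unit _ _ _ _ _ (fun k => I (inord k)) u) => //.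
- by rewrite gt_eqF.
- by rewrite gt_eqF.
- have [s s0 ->] := yx 1%N (ltnW M2); rewrite scaler_eq0 gt_eqF//=.
  exact: labelling_neq0 xK _.
- by move=> i _; rewrite /y mulmx_expr.
- by rewrite /y -mulmx_expr E addrC expr0 mul1mx expr1.
- by apply: proportional_separator => // i iM; have [s _ ->] := yx i iM; exists s.
Qed.
End Indecomposability.

(** * The complement of vertex 1 when all relations are geometric *)

Section BalancedComplement.
Context {R : realType} {n M : nat}.
Local Notation V := 'cV[R]_n.
Variables (K : set V) (x : 'I_M.+1 -> V) (y : nat -> V) (phi : {linear V -> R^o}).
Variables (b r : R) (u : nat -> R).
Hypotheses (clK : closed K) (cK : convex_cone K) (pK : pointed_cone K).
Hypotheses (xK : extreme_labelling K x) (M3 : (2 < M)%N).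
Hypothesis yx : forall k, (k <= M)%N -> exists2 s : R, 0 < s & y k = s *: x (inord k).
Hypotheses (phi1 : phi (x (inord 1)) = 1)
  (phi_neq1 : forall i, i != inord 1 -> phi (x i) = 0).
Hypotheses (b0 : 0 < b) (r0 : r < 0) (brM : b * r ^+ M = 1).
Hypothesis relation_geometric : forall v, linear_relation M y v ->
  v 1%N = 0 /\ forall i, (1 < i)%N -> (i <= M)%N -> v i = b * r ^+ i.-1 * v 0%N.
Hypotheses (ru : linear_relation M y u) (u0 : u 0%N != 0).

Let M1 : (0 < M)%N := ltnW (ltnW M3).
Let K' := K `&` [set z | phi z = 0].
Let clK' : closed K' := complement_closed clK.
Let cK' : convex_cone K' := complement_cone phi cK.
Let pK' : pointed_cone K' := complement_pointed phi cK pK.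
Let xK' : extreme_labelling K' (fun k => x (lift (inord 1) k)) :=
  complement_labelling clK cK pK xK phi1 phi_neq1.

Let br_neq0 k : b * r ^+ k != 0.
Proof. by rewrite mulf_eq0 expf_eq0 (gt_eqF b0) (lt_eqF r0) andbF. Qed.

Let y_extreme k : (k <= M)%N -> k != 1%N -> extreme_vector K' (y k).
Proof.
move=> kM k1; have [s s0 ->] := yx kM; apply: extremeZ => //.
apply/(complement_extreme clK cK pK xK phi1 phi_neq1).
split; first exact: labelling_extreme xK _.
by apply: phi_neq1; rewrite -val_eqE /= !inordK // ltnW.
Qed.

Let lift_y (k : 'I_M) : exists j (s : R),
  [/\ (j <= M)%N, j != 1%N, 0 < s, inord j = lift (inord 1) k & x (lift (inord 1) k) = s *: y j].
Proof.
pose i : 'I_M.+1 := lift (inord 1) k.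
have iM : (i <= M)%N by rewrite -ltnS.
have [s s0 yE] := yx iM; rewrite inord_val in yE.
exists i, s^-1; split; rewrite ?invr_gt0 ?inord_val//; last first.
  by rewrite yE scalerA mulVf ?gt_eqF// scale1r.
apply/eqP => i1; have /eqP := neq_lift (inord 1) k; apply; apply: val_inj.
by rewrite -[RHS]/(i : nat) i1 /= inordK// ltnS.
Qed.

Lemma relation0_eq : y 0%N = - \sum_(i < M.-1) (b * r ^+ i.+1) *: y i.+2.
Proof.
have [u1 ui] := relation_geometric ru.
have := ru; rewrite /linear_relation (sum_ord_recl2 (fun i => u i *: y i) M1).
rewrite u1 scale0r addr0.
have -> : \sum_(i < M.-1) u i.+2 *: y i.+2 =
    u 0%N *: \sum_(i < M.-1) (b * r ^+ i.+1) *: y i.+2.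
  rewrite scaler_sumr; apply: eq_bigr => i _; rewrite ui ?scalerA 1?mulrC//.
  by have := ltn_ord i; rewrite -ltnS prednK.
by rewrite -scalerDr => /eqP; rewrite scaler_eq0 (negbTE u0) addr_eq0 => /eqP.
Qed.

(** The vectors [y 2], ..., [y M] form a basis of the span: a relation with coefficient 0 at vertex
    0 is trivial, and [relation0_eq] recovers [y 0]. *)
Lemma complement_dim : cone_dim K' = M.-1.
Proof.
pose X := [tuple y i.+2 | i < M.-1].
have XE (i : 'I_M.-1) : X`_i = y i.+2 by rewrite -tnth_nth tnth_mktuple.
have iM (i : 'I_M.-1) : (i.+2 <= M)%N by have := ltn_ord i; rewrite -ltnS prednK.
have Xfree : free X.
  apply/freeP => k; under eq_bigr do rewrite XE.
  move=> kE.
  (* Extension by zero to the vertices 0 and 1. *)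
  pose v j := if j is j'.+2 then oapp k 0 (insub j' : option 'I_M.-1) else 0.
  have vk (i : 'I_M.-1) : v i.+2 = k i by rewrite /v valK.
  have rv : linear_relation M y v.
    rewrite /linear_relation (sum_ord_recl2 (fun i => v i *: y i) M1).
    by rewrite !scale0r !add0r -[RHS]kE; apply: eq_bigr => i _; rewrite vk.
  move=> i; rewrite -vk; have [_ ->//] := relation_geometric rv.
  by rewrite mulr0.
have spanX : (span X <= lspan K')%VS.
  apply/span_subvP => _ /mapP[i _ ->]; apply: sub_lspan.
  by have [] := y_extreme (iM i) isT.
have lspanX : (lspan K' <= span X)%VS.
  apply: lspan_min => z /(labelling_generates clK' cK' pK' xK')[c _ ->] /=.
  apply: memv_suml => k _; rewrite memvZ//.
  have [[|[|j]] [s [jM j1 _ _ ->]]] := lift_y k; rewrite memvZ//.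
    rewrite relation0_eq memvN; apply: memv_suml => i _; rewrite memvZ// memv_span//.
    by apply/mapP; exists i; rewrite ?mem_enum.
  have jM' : (j < M.-1)%N by rewrite -ltnS prednK.
  by rewrite memv_span//; apply/mapP; exists (Ordinal jM'); rewrite ?mem_enum.
have /eqP XK : lspan K' == span X by rewrite eqEsubv lspanX.
by rewrite /cone_dim XK; move: Xfree; rewrite /free size_tuple => /eqP.
Qed.

Lemma complement_minimal : minimal_cone K'.
Proof.
rewrite /minimal_cone; have := labelling_polyhedral clK' cK' pK' xK'.
by rewrite complement_dim prednK.
Qed.

(** The projection turns the relation into another, with each coefficient kept or erased. Relations
    are proportional and all coefficients away from 1 are nonzero, so all are kept or all are
    erased. *)
Lemma complement_indecomposable : indecomposable K'.
Proof.
move=> decK'.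
have gen z : K' z -> exists c : 'I_M -> R, z = \sum_i c i *: x (lift (inord 1) i).
  by move=> /(labelling_generates clK' cK' pK' xK')[c _ ->]; exists c.
have [P [I [PI [i Ii] [j Ij]]]] :=
  decomposable_projection cK' (labelling_extreme xK') gen decK'.
pose e k := if unlift (inord 1) (inord k : 'I_M.+1) is Some l then I l else false.
have ey k : (k <= M)%N -> k != 1%N -> P *m y k = (e k)%:R *: y k.
  move=> kM k1; have [s s0 ->] := yx kM; rewrite /e; case: unliftP => [l kl|/(congr1 val)/eqP].
    by rewrite kl -scalemxAr PI !scalerA mulrC.
  by rewrite /= !inordK// ?(negbTE k1)// ltnW.
have [u1 uj] := relation_geometric ru.
have rv : linear_relation M y (fun k => (e k)%:R * u k).
  move: ru => /(congr1 (mulmx P)); rewrite mulmx0 mulmx_sumr /linear_relation => R0.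
  rewrite -[RHS]R0; apply: eq_bigr => k _; rewrite -scalemxAr.
  have [k1|k1] := eqVneq (k : nat) 1%N; first by rewrite k1 u1 mulr0 !scale0r.
  by rewrite ey// ?scalerA 1?mulrC// -ltnS.
have econst k : (k <= M)%N -> k != 1%N -> e k = e 0%N.
  case: k => [|[|k]]// kM _; have [_ /(_ k.+2 isT kM)] := relation_geometric rv.
  rewrite uj//= => E.
  have /eqP : ((e k.+2)%:R - (e 0%N)%:R) * (b * r ^+ k.+1 * u 0%N) = 0.
    by rewrite mulrBl E; ring.
  rewrite !mulf_eq0 -mulf_eq0 (negbTE (br_neq0 _)) (negbTE u0) !orbF subr_eq0 eqr_nat.
  by case: (e k.+2); case: (e 0%N).
have eI (l : 'I_M) : I l = e 0%N.
  have [k [_ [kM k1 _ kl _]]] := lift_y l.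
  by rewrite -(econst k)// /e kl liftK.
by move: Ij; rewrite eI -(eI i) Ii.
Qed.

(** For odd [M] the product [b * r ^+ M] would be negative. *)
Lemma near_even : ~~ odd M.
Proof.
apply/negP => oM; have := ltr01 (R := R); rewrite -brM.
have -> : r ^+ M = - ((- r) ^+ M) by rewrite exprNn -signr_odd oM expr1 mulN1r opprK.
by rewrite mulrN oppr_gt0 ltNge mulr_ge0 ?exprn_ge0 ?oppr_ge0 ?ltW.
Qed.

(* Alternating signs: the vertices [0, 3, 5, ..., M-1] are on one side of the
   relation and [2, 4, ..., M] on the other. *)
Lemma complement_balanced : balanced K'.
Proof.
have [h Mh] : exists h, M = h.+1.*2.
  exists M./2.-1; rewrite prednK; first by rewrite -[LHS]odd_double_half (negbTE near_even).
  by rewrite half_gt0 ltnW.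
pose idx (s : 'I_h.+1 + 'I_h.+1) := match s with
  | inl i => if (i : nat) is k.+1 then k.*2.+3 else 0%N | inr j => j.*2.+2 end.
pose al (i : 'I_h.+1) : R := if (i : nat) is k.+1 then b * r ^+ k.*2.+2 else 1.
pose be (j : 'I_h.+1) : R := - (b * r ^+ j.*2.+1).
have idxM s : (idx s <= M)%N.
  by case: s => [[[|k] /= kh]|[k /= kh]]; rewrite Mh//; lia.
have idx1 s : idx s != 1%N by case: s => [[[|k] kh]|[k kh]].
have idx_inj : injective idx.
  move=> [[i ih]|[i ih]] [[j jh]|[j jh]] /= E.
  - by congr inl; apply/val_inj => /=; case: i j E {ih jh} => [|i] [|j]//= E; lia.
  - by exfalso; case: i E {ih} => [|i]//=; lia.
  - by exfalso; case: j E {jh} => [|j]//=; lia.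
  - by congr inr; apply/val_inj => /=; lia.
exists h.+1, h.+1, al, (fun i => y (idx (inl i))), be, (fun j => y (idx (inr j))).
split; last by rewrite leqnSn.
split=> //.
- split=> [i|j].
    rewrite /al; case: (i : nat) => [|k]; first exact: ltr01.
    by rewrite mulr_gt0// exprn_even_gt0 ?(lt_eqF r0)//= negbK odd_double.
  by rewrite /be oppr_gt0 pmulr_rlt0// exprn_odd_lt0//= odd_double.
- split=> [s|s t st [c E]].
    by have -> : (match s with inl i => y (idx (inl i)) | inr j => y (idx (inr j)) end) = y (idx s);
      [case: s|exact: y_extreme].
  apply: st; apply: idx_inj.
  have {}E : y (idx s) = c *: y (idx t) by case: s E; case: t.
  have [p p0 pE] := yx (idxM s); have [q q0 qE] := yx (idxM t).
  have : x (inord (idx s)) = (p^-1 * (c * q)) *: x (inord (idx t)).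
    by rewrite -scalerA -scalerA -qE -E pE scalerA mulVf ?gt_eqF// scale1r.
  by move=> /(labelling_distinct xK) /(congr1 val) /=; rewrite !inordK ?ltnS.
rewrite big_ord_recl /= scale1r relation0_eq /be.
have -> : M.-1 = (h.*2.+1)%N by rewrite Mh.
(* Separates the terms by parity of the exponent of [r], that is, by sign. *)
have split_sum (G : nat -> V) : \sum_(i < h.*2.+1) G i =
    \sum_(i < h) G i.*2.+1 + \sum_(j < h.+1) G j.*2.
  elim: h {Mh idx al be idxM idx1 idx_inj} => [|h IH]; first by rewrite !big_ord1 big_ord0 add0r.
  rewrite doubleS big_ord_recr big_ord_recr /= IH [in RHS]big_ord_recr [X in _ = _ + X]big_ord_recr /=.
  by rewrite -!addrA; congr (_ + _); rewrite addrCA.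
rewrite (split_sum (fun i => (b * r ^+ i.+1) *: y i.+2)) opprD addrAC addNr add0r -sumrN.
by apply: eq_bigr => j _; rewrite scaleNr.
Qed.

End BalancedComplement.

(** * Decomposable non-simplicial cones with digraph [F2] *)

Section NearWielandtDecomposable.
Context {R : realType} {n M : nat}.
Local Notation V := 'cV[R]_n.+1.
Variables (K : set V) (x : 'I_M.+1 -> V) (A : 'M[R]_n.+1).
Hypotheses (clK : closed K) (cK : convex_cone K) (pK : pointed_cone K).
Hypotheses (xK : extreme_labelling K x) (AK : cone_nonneg K A).
Hypotheses (M3 : (2 < M)%N) (nM : (n.+1 < M.+1)%N) (A_unit : A \in unitmx).

Lemma F2_decomposable : digraph_given_by K A x (@F2 M.+1) -> decomposable K ->
  odd M.+1 /\ exists (w : V) (K' : set V), [/\ w != 0, direct_sum K (ray w) K',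
    indecomposable K', minimal_cone K' & balanced K'].
Proof.
move=> AF /(labelling_projection clK cK pK xK)[P [I [PI It If]]].
have M1 : (0 < M)%N := ltnW (ltnW M3).
have [s [e [a [b [s0 e0 a0 b0 [E E0]]]]]] := F2_power_top clK cK pK xK AK (ltnW M3) AF.
pose v := x (inord 1).
(* Vertex 0 is scaled by [s] and the others follow the orbit of [x_1], which gives the normal form
   of the [NearWielandt] hypotheses. *)
pose y k := if k is k'.+1 then A ^+ k' *m v else s *: x (inord 0).
have yx k : (k <= M)%N -> exists2 t : R, 0 < t & y k = t *: x (inord k).
  by case: k => [|k] kM; [exists s|exact: (F2_power clK cK pK xK AK AF)].
have y0 k : (k <= M)%N -> y k != 0.
  move=> /yx[t t0 ->]; rewrite scaler_eq0 gt_eqF//=; exact: labelling_neq0 xK _.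
have Ay0 : A *m y 0%N = a *: y 1%N + b *: y 2%N.
  by rewrite /y E0 expr0 mul1mx expr1.
have Ay i : (0 < i)%N -> (i < M)%N -> A *m y i = y i.+1.
  by case: i => // i _ _; rewrite /y mulmx_expr.
have AyM : A *m y M = y 0%N + e *: y 1%N.
  have yS k : (0 < k)%N -> y k = A ^+ k.-1 *m v by case: k.
  by rewrite yS// -mulmx_expr prednK// E /y expr0 mul1mx.
have yxs k : (k <= M)%N -> exists t, y k = t *: x (inord k).
  by move=> /yx[t _ ->]; exists t.
have sI := proportional_separator PI yxs.
have [u [ru u0]] := linear_relation_exists y nM.
have iso := near_separator M3 A_unit a0 b0 e0 y0 Ay0 Ay AyM sI ru u0 (nonconstant It If).
have Z1 w : linear_relation M y w -> w 1%N = 0 := isolated_relation0 M1 iso.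
have geo := near_relation_geometric M3 A_unit a0 Ay0 Ay AyM Z1.
(* All coefficients are determined by the one at 0, so a nontrivial relation involves vertex 0. *)
have u00 : u 0%N != 0.
  apply/eqP => u00; have [k kM /eqP] := u0; apply.
  by case: k kM => [|[|k]] kM; [|exact: Z1|rewrite (geo _ ru)// u00 mulr0].
have brM := near_relation_ratio M3 A_unit a0 Ay0 Ay AyM Z1 ru u00.
have r0 : - (e / a) < 0 by rewrite oppr_lt0 divr_gt0.
have [B B1 Bi] := iso.
have [phi [phi1 phin]] : exists phi : {linear V -> R^o}, phi (x (inord 1)) = 1 /\
    forall i, i != inord 1 -> phi (x i) = 0.
  apply: (@isolated_functional _ _ _ x B).
    by move: B1; rewrite /y expr0 mul1mx.
  move=> i i1; have iM : (i <= M)%N by rewrite -ltnS.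
  have [t t0 yi] := yx i iM; rewrite inord_val in yi.
  have i1' : i != 1%N :> nat.
    by apply: contra i1 => /eqP i1; apply/eqP/val_inj; rewrite /= inordK// ltnS.
  have := Bi _ iM i1'; rewrite yi -scalemxAr => /eqP.
  by rewrite scaler_eq0 gt_eqF//= => /eqP.
have geo' w : linear_relation M y w -> w 1%N = 0 /\
    forall i, (1 < i)%N -> (i <= M)%N -> w i = b * (- (e / a)) ^+ i.-1 * w 0%N.
  by move=> rw; split; [exact: Z1|exact: geo].
split; first by rewrite /= (near_even b0 r0 brM).
exists (x (inord 1)), (K `&` [set z | phi z = 0]); split.
- exact: labelling_neq0 xK _.
- exact: complement_direct_sum clK cK pK xK phi1 phin.
- exact: (complement_indecomposable clK cK pK xK M3 yx phi1 phin b0 r0 geo' ru u00).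
- exact: (complement_minimal clK cK pK xK M3 yx phi1 phin geo' ru u00).
- exact: (complement_balanced clK cK pK xK M3 yx phi1 phin b0 r0 brM geo' ru u00).
Qed.
End NearWielandtDecomposable.

Theorem lemma4p2 (R : realType) (n m : nat) (K : set 'cV[R]_n.+1)
    (A : 'M[R]_n.+1) (x : 'I_m -> 'cV[R]_n.+1)
    (hn : (3 <= n.+1)%N) (hnm : (n.+1 <= m)%N)
    (hK : polyhedral_cone m n.+1 K) (hA : cone_nonneg K A)
    (hx : extreme_labelling K x)
    (hF : digraph_given_by K A x (@F1 m) \/ digraph_given_by K A x (@F2 m)) :
  (* (i) *)
  [/\ cone_primitive K A, A \in unitmx, nonderogatory A
    & exists! p : {poly R},
        (exists c d : R, [/\ 0 < c, 0 < d & p = 'X^m - c *: 'X - d%:P]) /\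
        horner_mx A p = 0] /\
  (* (ii) *)
  [/\ digraph_given_by K A x (@F1 m) ->
        exists2 i : 'I_m, i = 0%N :> nat & exponent K A = local_exponent K A (x i),
      digraph_given_by K A x (@F2 m) ->
        exists2 i : 'I_m, i = 1%N :> nat & exponent K A = local_exponent K A (x i)
    & exists! i : 'I_m, forall j : 'I_m,
        (local_exponent K A (x j) <= local_exponent K A (x i))%E] /\
  (* (iii) *)
  (~ simplicial K ->
     (digraph_given_by K A x (@F1 m) -> indecomposable K) /\
     (digraph_given_by K A x (@F2 m) ->
        indecomposable K \/
        (odd m /\ exists (w : 'cV[R]_n.+1) (K' : set 'cV[R]_n.+1),
           [/\ w != 0, direct_sum K (ray w) K', indecomposable K',
               minimal_cone K' & balanced K']))).
Proof.
case: m x hnm hK hx hF => [|M] x hnm hK hx hF; first by rewrite ltn0 in hnm.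
have [[clK cK pK _] dimK _] := hK.
have M2 : (1 < M)%N by exact: leq_trans hn hnm.
have Kfull : lspan K = fullv.
  by apply/eqP; rewrite eqEdim subvf /= -/(cone_dim K) dimK dimvf /dim /= muln1 leqnn.
have F1_case := F1_conclusion clK cK pK hx Kfull hA M2.
have F2_case := F2_conclusion clK cK pK hx Kfull hA M2.
have M1 := ltnW M2.
split; first by case: hF => [/F1_case[]|/F2_case[]].
split; last first.
  move=> nsimp; have nM : (n.+1 < M.+1)%N.
    rewrite ltn_neqAle hnm andbT; apply/eqP => nM; apply: nsimp.
    by move: hK; rewrite /simplicial dimK -nM.
  have Au : A \in unitmx by case: hF => [/F1_case|/F2_case] [[]].
  split=> AF; first exact: (F1_indecomposable clK cK pK hx hA M2 nM Au AF).
  have [decK|] := pselect (decomposable K); last by left.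
  right; apply: (F2_decomposable clK cK pK hx hA _ nM Au AF decK).
  (* Non-simpliciality gives [3 <= n.+1 <= M], so vertices 0, 1, 2 and [M] are distinct. *)
  exact: leq_trans hn (nM : (n.+1 <= M)%N).
split.
- by move=> /F1_case[_ []]; exists (inord 0); rewrite ?inordK.
- by move=> /F2_case[_ []]; exists (inord 1); rewrite ?inordK ?ltnS.
- by case: hF => [/F1_case|/F2_case] [_ []].
Qed.
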